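(* Let $G$ be a group. Then $Hyp(G)$ is a submonoid of $Cen(G)$ (under pointwise multiplication). It is closed under ultralimits (if $\varphi_n\in Hyp(G)$ for all $n\in\mathbb N$ and $\omega$ is an ultrafilter on $\mathbb N$, then the pointwise ultralimit $\lim_{n\to\omega}\varphi_n$ belongs to $Hyp(G)$) and under convex combinations. Moreover, if $G$ is countable, then $0(Hyp(G))=\{\delta_e\}$ if and only if $G$ is hyperlinear in the classical sense of Rădulescu.
   Context: $Cen(G)$ is the set of functions $\varphi:G\to\mathbb C$ that are positive definite, constant on conjugacy classes, and satisfy $\varphi(e)=1$; it is a monoid under pointwise product, with neutral element the constant function $1$. $\delta_e\in Cen(G)$ is given by $\delta_e(e)=1$ and $\delta_e(g)=0$ for $g\neq e$. $R$ is the hyperfinite type $II_1$ factor; for a free ultrafilter $\rho$ on $\mathbb N$, $R^\rho$ is the tracial ultrapower of $R$, $\tau$ its trace, $U(R^\rho)$ its unitary group. $Hyp(G)$ is the set of $\varphi\in Cen(G)$ for which there is a homomorphism $\theta_\varphi:G\to U(R^\rho)$, for some free ultrafilter $\rho$ on $\mathbb N$, with $\tau(\theta_\varphi(g))=\varphi(g)$ for all $g\in G$. For a monoid $(X,\cdot)$, $0(X)=\{x\in X: x\cdot y=y\cdot x=x\ \ \forall y\in X\}$ is the set of annihilators. A group $G$ is hyperlinear in the classical sense of Rădulescu if there is an injective homomorphism $G\to U(R^\rho)$ for some free ultrafilter $\rho$ on $\mathbb N$ (Rădulescu's definition was for countable i.c.c. groups; the i.c.c. property is not required here). *)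

(* Defs.v *)
From HB Require Import structures.
From mathcomp Require Import all_boot all_order all_algebra.
From mathcomp Require Import complex.
From mathcomp Require Import boolp classical_sets functions cardinality reals.
From mathcomp Require Import topology normedtype.
From mathcomp Require Import ring.

Set Implicit Arguments.
Unset Strict Implicit.
Unset Printing Implicit Defensive.
Import Order.TTheory GRing.Theory Num.Theory numFieldNormedType.Exports.
Local Open Scope classical_set_scope.
Local Open Scope ring_scope.
Local Open Scope quotient_scope.

(* Throughout, C stands for the field of complex numbers. The definitions only
   use that C is a numClosedFieldType, which equips it with the topology of its
   norm; they are meant to be instantiated with C := K[i] for K : realType.
   Recall that z <= t in C means that t - z is a nonnegative real number. *)

(* dot is linear in its first argument and conjugate-linear in the second. *)
Record hilbert (C : numClosedFieldType) := Hilbert {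
  hspace :> completeNormedModType C;
  dot : {dot hspace for @Num.conj C};
  dot_norm : forall u : hspace, `|u| ^+ 2 = dot u u
}.

Arguments dot {C h}.

Section Operators.
Context (C : numClosedFieldType) (H : hilbert C).
Implicit Types (x y : H -> H) (A : set (H -> H)).

Definition bounded_op x :=
  linear x /\ exists c : C, forall u, `|x u| <= c * `|u|.

Definition adjoint_of x y := forall u v, dot (x u) v = dot u (y v).

Definition commutant A : set (H -> H) :=
  [set y | bounded_op y /\ forall x, A x -> x \o y = y \o x].

Definition von_neumann_algebra A :=
  (forall x, A x -> exists2 y, A y & adjoint_of x y) /\
  commutant (commutant A) = A.

Definition factor A := A `&` commutant A = range (fun (c : C) u => c *: u).

Definition finite_dimensional A :=
  exists (n : nat) (b : 'I_n -> H -> H), forall x, A x ->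
    exists c : 'I_n -> C, forall u, x u = \sum_(i < n) c i *: b i u.

Definition star_morphism n (f : 'M[C]_n -> H -> H) :=
  [/\ forall (a : C) P Q u, f (a *: P + Q) u = a *: f P u + f Q u,
      f 1%:M = id,
      forall P Q, f (P *m Q) = f P \o f Q &
      forall P, adjoint_of (f P) (f (map_mx Num.conj P^T))].

Definition matrix_subalgebra A :=
  exists (n : nat) (f : 'M[C]_n -> H -> H),
    [/\ star_morphism f, injective f & A = range f].

(* Hyperfiniteness of a II_1 factor in the sense of Murray and von Neumann:
   it is generated, as a von Neumann algebra, by an increasing sequence of
   subfactors of type I_n, with n finite and the same unit. *)
Definition hyperfinite A :=
  exists N : nat -> set (H -> H),
    [/\ forall k, N k `<=` N k.+1,
        forall k, matrix_subalgebra (N k) &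
        commutant (commutant (\bigcup_k N k)) = A].

End Operators.

(* The hyperfinite II_1 factor: an infinite-dimensional hyperfinite factor with
   a faithful normal tracial state. It is represented on a Hilbert space in
   such a way that its trace is the vector state x |-> <x Omega, Omega> (for
   instance in its GNS representation), which makes the trace normal.
   By Murray and von Neumann, the pair (algebra, trace) is unique up to
   isomorphism. *)
Record hyperfiniteII1 (C : numClosedFieldType) := HyperfiniteII1 {
  Hspace : hilbert C;
  Ralg : set (Hspace -> Hspace);
  Omega : Hspace;
  R_von_neumann : von_neumann_algebra Ralg;
  R_factor : factor Ralg;
  R_infinite : ~ finite_dimensional Ralg;
  R_hyperfinite : hyperfinite Ralg;
  Omega_unit : `|Omega| = 1;
  Omega_trace : forall x y, Ralg x -> Ralg y ->
    dot (x (y Omega)) Omega = dot (y (x Omega)) Omega;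
  Omega_faithful : forall x, Ralg x -> x Omega = 0 -> forall u, x u = 0
}.

Definition trace (C : numClosedFieldType) (R : hyperfiniteII1 C)
  (x : Hspace R -> Hspace R) : C := dot (x (Omega R)) (Omega R).

(* norm2 x = trace (x^* x) ^ (1/2) *)
Definition norm2 (C : numClosedFieldType) (R : hyperfiniteII1 C)
  (x : Hspace R -> Hspace R) : C := `|x (Omega R)|.

Record free_ultrafilter := FreeUltrafilter {
  fuf : set_system nat;
  fuf_ultra : UltraFilter fuf;
  fuf_free : \bigcap_(A in fuf) A = set0
}.

#[global] Existing Instance fuf_ultra.

Section OperatorTheory.
Context (C : numClosedFieldType) (H : hilbert C).
Implicit Types (x y : H -> H) (A : set (H -> H)).

Lemma dotC (u v : H) : dot u v = (dot v u)^*.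
Proof. by rewrite (hermC (@dot C H)) expr0 mul1r. Qed.

Lemma commutant_id A : commutant A id.
Proof.
split=> //; split=> //.
by exists 1 => u; rewrite mul1r.
Qed.

Lemma commutant_comp A x y : commutant A x -> commutant A y ->
  commutant A (x \o y).
Proof.
move=> [[xL [c xc]] xA] [[yL [d yd]] yA]; split.
  split; first by move=> a u v /=; rewrite yL xL.
  exists (`|c| * `|d|) => u /=.
  have le u' e (z : H -> H) : `|z u'| <= e * `|u'| -> `|z u'| <= `|e| * `|u'|.
    move=> zu; have e0 : 0 <= e * `|u'| by exact: le_trans zu.
    by rewrite -[`|u'|]normr_id -normrM ger0_norm.
  rewrite -mulrA; apply: (le_trans (le _ _ _ (xc _))).
  by apply: ler_wpM2l => //; exact: le.
move=> z Az; rewrite compA (xA z Az) -compA (yA z Az).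
by [].
Qed.

Lemma commutant_sub A x y : (forall z, A z -> linear z) ->
  commutant A x -> commutant A y -> commutant A (fun u => x u - y u).
Proof.
move=> AL [[xL [c xc]] xA] [[yL [d yd]] yA]; split.
  split.
    by move=> a u v /=; rewrite xL yL opprD addrACA scalerBr.
  by exists (c + d) => u; rewrite (le_trans (ler_normB _ _))// mulrDl lerD.
move=> z Az; apply/funext => u /=.
have -> : z (x u - y u) = z (x u) - z (y u).
  by rewrite addrC -scaleN1r (AL z Az) scaleN1r addrC.
by have /= -> := congr1 (@^~ u) (xA z Az); have /= -> := congr1 (@^~ u) (yA z Az).
Qed.

End OperatorTheory.

(* R^rho is the quotient of the algebra of norm-bounded sequences in R by
   the ideal of those x with lim_(n -> rho) norm2 (x n) = 0. Only the
   multiplication, the unit, the involution and the trace of R^rho are needed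
   to define its unitary group. *)
Record bounded_seq (C : numClosedFieldType) (R : hyperfiniteII1 C) :=
  BoundedSeq {
    bseq :> nat -> Hspace R -> Hspace R;
    bseq_in : forall n, Ralg (bseq n);
    bseq_bounded : exists c : C, forall n u, `|bseq n u| <= c * `|u|
  }.

HB.instance Definition _ C R := gen_eqMixin (@bounded_seq C R).
HB.instance Definition _ C R := gen_choiceMixin (@bounded_seq C R).

Section Algebra.
Context (C : numClosedFieldType) (R : hyperfiniteII1 C).
Implicit Types x y : Hspace R -> Hspace R.
Local Notation M := (@Ralg C R).
Local Notation Om := (@Omega C R).

Lemma Ralg_bicommutant x : M x = commutant (commutant M) x.
Proof. by rewrite (R_von_neumann R).2. Qed.

Lemma Ralg_id : M id.
Proof. by rewrite Ralg_bicommutant; exact: commutant_id. Qed.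

Lemma Ralg_comp x y : M x -> M y -> M (x \o y).
Proof. by rewrite !Ralg_bicommutant; exact: commutant_comp. Qed.

Lemma Ralg_linear x : M x -> linear x.
Proof. by rewrite Ralg_bicommutant => -[[]]. Qed.

Lemma Ralg_sub x u v : M x -> x (u - v) = x u - x v.
Proof.
by move/Ralg_linear => xL; rewrite addrC -scaleN1r xL scaleN1r addrC.
Qed.

Lemma Ralg_diff x y : M x -> M y -> M (fun u => x u - y u).
Proof.
rewrite !Ralg_bicommutant; apply: commutant_sub => z Mz.
by case: Mz => -[].
Qed.

Lemma adj_ex x : exists y, M x -> M y /\ adjoint_of x y.
Proof.
have [Mx|nMx] := pselect (M x); last by exists x.
by have [y My xy] := (R_von_neumann R).1 x Mx; exists y.
Qed.

Definition adj x := projT1 (cid (adj_ex x)).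

Lemma Ralg_adj x : M x -> M (adj x).
Proof. by move=> /(projT2 (cid (adj_ex x)))[]. Qed.

Lemma adjE x u v : M x -> dot (x u) v = dot u (adj x v).
Proof. by move=> /(projT2 (cid (adj_ex x)))[_]; exact. Qed.

Lemma adjEl x u v : M x -> dot (adj x u) v = dot u (x v).
Proof. by move=> Mx; rewrite dotC -adjE// -dotC. Qed.

Lemma dot_inj (u v : Hspace R) : (forall w, dot w u = dot w v) -> u = v.
Proof.
move=> uv; apply/eqP; rewrite -subr_eq0 -normr_eq0 -sqrf_eq0 dot_norm.
by rewrite linearBr /= uv subrr.
Qed.

Lemma adjK x u : M x -> adj (adj x) u = x u.
Proof.
by move=> Mx; apply: dot_inj => w; rewrite -adjE ?adjEl//; exact: Ralg_adj.
Qed.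

Lemma adj_comp x y u : M x -> M y -> adj (x \o y) u = adj y (adj x u).
Proof.
move=> Mx My; apply: dot_inj => w.
by rewrite -!adjE//; exact: Ralg_comp.
Qed.

Lemma adj_diff x y u : M x -> M y ->
  adj (fun v => x v - y v) u = adj x u - adj y u.
Proof.
move=> Mx My; apply: dot_inj => w; rewrite -adjE; last exact: Ralg_diff.
by rewrite linearBl linearBr /= -!adjE.
Qed.

Lemma adj_id u : adj id u = u.
Proof. by apply: dot_inj => w; rewrite -adjE//; exact: Ralg_id. Qed.

Lemma norm_adj x (c : C) v : M x -> 0 < c ->
  (forall u, `|x u| <= c * `|u|) -> `|adj x v| <= c * `|v|.
Proof.
move=> Mx c0 xc; rewrite -(@ler_pXn2r _ 2) ?nnegrE ?mulr_ge0// ?(ltW c0)//.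
set w := adj x v; set t := `|w| ^+ 2.
have tE : dot (x w) v = t by rewrite adjE// /t dot_norm.
have tE' : dot v (x w) = t.
  by rewrite dotC tE; apply/CrealP; rewrite realX// normr_real.
have c2r : (c ^+ 2)^* = c ^+ 2 by apply/CrealP; rewrite realX// gtr0_real.
have xw : 0 <= c ^+ 2 * t - `|x w| ^+ 2.
  by rewrite subr_ge0 /t -exprMn ler_pXn2r ?nnegrE ?mulr_ge0// ltW.
have : 0 <= `|x w - c ^+ 2 *: v| ^+ 2 by rewrite exprn_ge0.
rewrite dot_norm linearBl !linearBr /= !linearZl_LR !linearZr_LR /=.
rewrite -!dot_norm c2r tE tE' => /addr_ge0 /(_ xw).
have -> : `|x w| ^+ 2 - c ^+ 2 * t - (c ^+ 2 * t - c ^+ 2 * (c ^+ 2 * `|v| ^+ 2))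
    + (c ^+ 2 * t - `|x w| ^+ 2) = c ^+ 2 * ((c * `|v|) ^+ 2 - t) by ring.
by rewrite pmulr_rge0 ?exprn_gt0// subr_ge0.
Qed.

Lemma norm2_adj x : M x -> norm2 (adj x) = norm2 x.
Proof.
move=> Mx; apply/eqP; rewrite -(@eqrXn2 _ 2) ?normr_ge0// !dot_norm.
by rewrite -adjE// Omega_trace ?adjEl//; exact: Ralg_adj.
Qed.

Lemma norm2_comp x y (d : C) : M x -> M y -> 0 < d ->
  (forall u, `|y u| <= d * `|u|) -> norm2 (x \o y) <= d * norm2 x.
Proof.
move=> Mx My d0 yd; rewrite -(norm2_adj Mx) -norm2_adj; last exact: Ralg_comp.
by rewrite /norm2 adj_comp//; exact: norm_adj.
Qed.

Lemma bounded_seq_gt0 (x : bounded_seq R) :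
  exists2 c : C, 0 < c & forall n u, `|x n u| <= c * `|u|.
Proof.
have [c xc] := bseq_bounded x; exists (`|c| + 1); first by rewrite ltr_wpDl.
move=> n u; have cu := xc n u; apply: (@le_trans _ _ (`|c| * `|u|)).
  have e0 : 0 <= c * `|u| by exact: le_trans cu.
  by rewrite -[`|u| in leRHS]normr_id -normrM ger0_norm.
by rewrite mulrDl mul1r lerDl.
Qed.

Fact bmul_bounded (x y : bounded_seq R) :
  exists c : C, forall n u, `|(x n \o y n) u| <= c * `|u|.
Proof.
have [c c0 xc] := bounded_seq_gt0 x; have [d d0 yd] := bounded_seq_gt0 y.
exists (c * d) => n u /=; apply: (le_trans (xc _ _)).
by rewrite -mulrA ler_pM2l.
Qed.

Definition bmul (x y : bounded_seq R) := @BoundedSeq _ R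
  (fun n => x n \o y n) (fun n => Ralg_comp (bseq_in x n) (bseq_in y n))
  (bmul_bounded x y).

Fact bone_bounded : exists c : C,
  forall (n : nat) (u : Hspace R), `|id u| <= c * `|u|.
Proof. by exists 1 => n u; rewrite mul1r. Qed.

Definition bone := @BoundedSeq _ R
  (fun n => id) (fun n => Ralg_id) bone_bounded.

Fact bstar_bounded (x : bounded_seq R) :
  exists c : C, forall n u, `|adj (x n) u| <= c * `|u|.
Proof.
have [c c0 xc] := bounded_seq_gt0 x; exists c => n u.
by apply: norm_adj => //; exact: bseq_in.
Qed.

Definition bstar (x : bounded_seq R) := @BoundedSeq _ R
  (fun n => adj (x n)) (fun n => Ralg_adj (bseq_in x n)) (bstar_bounded x).

End Algebra.

Section Ultrapower.
Context (C : numClosedFieldType) (R : hyperfiniteII1 C).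
Variable rho : free_ultrafilter.
Implicit Types x y : bounded_seq R.

Definition ultra_eq x y : bool :=
  `[< norm2 (fun u => x n u - y n u) @[n --> fuf rho] --> (0 : C) >].

Lemma ultra_eqP x y : reflect
  (forall e : C, 0 < e -> \forall n \near fuf rho, norm2 (fun u => x n u - y n u) < e)
  (ultra_eq x y).
Proof.
apply: (iffP (asboolP _)) => [/cvgr0_norm_lt xy e /xy|xy].
  by apply: filterS => n; rewrite ger0_norm// normr_ge0.
apply/cvgr0Pnorm_lt => e /xy; apply: filterS => n.
by rewrite ger0_norm// normr_ge0.
Qed.

Lemma ultra_eq_ext x y : (forall n u, x n u = y n u) -> ultra_eq x y.
Proof.
move=> xy; apply/ultra_eqP => e e0; near=> n.
by rewrite /norm2 xy subrr normr0.
Unshelve. all: by end_near. Qed.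

Lemma ultra_eq_refl : reflexive ultra_eq.
Proof. by move=> x; exact: ultra_eq_ext. Qed.

Lemma ultra_eq_sym : symmetric ultra_eq.
Proof.
suff imp x y : ultra_eq x y -> ultra_eq y x by move=> x y; apply/idP/idP; exact: imp.
move=> /ultra_eqP xy; apply/ultra_eqP => e /xy; apply: filterS => n.
by rewrite /norm2 distrC.
Qed.

Lemma ultra_eq_trans : transitive ultra_eq.
Proof.
move=> y x z /ultra_eqP xy /ultra_eqP yz; apply/ultra_eqP => e e0.
have e20 : 0 < e / 2 by rewrite divr_gt0.
near=> n; rewrite [e](splitr e) (@le_lt_trans _ _ (norm2 (fun u => x n u - y n u)
  + norm2 (fun u => y n u - z n u)))//.
  by rewrite /norm2 ler_distD.
by rewrite ltrD//; near: n; [exact: xy|exact: yz].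
Unshelve. all: by end_near. Qed.

Canonical ultra_equiv :=
  EquivRel ultra_eq ultra_eq_refl ultra_eq_sym ultra_eq_trans.

Definition ultrapower := {eq_quot ultra_eq}.

HB.instance Definition _ := Choice.on ultrapower.
HB.instance Definition _ := EqQuotient.on ultrapower.

Lemma ultra_repr x : ultra_eq (repr (\pi_ultrapower x)) x.
Proof. by have /eqquotP := reprK (\pi_ultrapower x). Qed.

Lemma ultrapowerW (P : ultrapower -> Prop) :
  (forall x, P (\pi_ultrapower x)) -> forall X, P X.
Proof. exact: quotW. Qed.

Lemma pi_eq x y : ultra_eq x y -> \pi_ultrapower x = \pi_ultrapower y.
Proof. by move=> xy; apply/eqquotP. Qed.

Lemma ultra_eq_mul x x' y y' :
  ultra_eq x x' -> ultra_eq y y' -> ultra_eq (bmul x y) (bmul x' y').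
Proof.
move=> /ultra_eqP xx' /ultra_eqP yy'; apply/ultra_eqP => e e0.
have [c c0 xc] := bounded_seq_gt0 x; have [d d0 yd] := bounded_seq_gt0 y'.
have ec : 0 < e / 2 / c by rewrite !divr_gt0.
have ed : 0 < e / 2 / d by rewrite !divr_gt0.
near=> n; rewrite [e](splitr e).
rewrite (@le_lt_trans _ _ (c * norm2 (fun u => y n u - y' n u)
  + d * norm2 (fun u => x n u - x' n u)))//; last first.
  rewrite ltrD//; rewrite mulrC -ltr_pdivlMr//; near: n; [exact: yy'|exact: xx'].
have Mx := bseq_in x n; have Mx' := bseq_in x' n; have My' := bseq_in y' n.
apply: le_trans (lerD (xc n _) (norm2_comp (Ralg_diff Mx Mx') My' d0 (yd n))).
apply: le_trans (ler_normD _ _).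
by rewrite /norm2 /= (Ralg_sub _ _ Mx) addrA subrK.
Unshelve. all: by end_near. Qed.

Lemma ultra_eq_star x x' : ultra_eq x x' -> ultra_eq (bstar x) (bstar x').
Proof.
move=> /ultra_eqP xx'; apply/ultra_eqP => e /xx'; apply: filterS => n.
have Mx := bseq_in x n; have Mx' := bseq_in x' n.
rewrite -(norm2_adj (Ralg_diff Mx Mx')).
by rewrite /norm2 adj_diff.
Qed.

Definition umul (X Y : ultrapower) : ultrapower :=
  \pi_ultrapower (bmul (repr X) (repr Y)).
Definition uone : ultrapower := \pi_ultrapower (bone R).
Definition ustar (X : ultrapower) : ultrapower :=
  \pi_ultrapower (bstar (repr X)).

(* The limit exists when C is the field of complex numbers, and does not depend
   on the representative. *)
Definition utrace (X : ultrapower) : C :=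
  lim (trace (repr X n) @[n --> fuf rho]).

Lemma umul_pi x y :
  umul (\pi_ultrapower x) (\pi_ultrapower y) = \pi_ultrapower (bmul x y).
Proof. by apply/pi_eq/ultra_eq_mul; exact: ultra_repr. Qed.

Lemma ustar_pi x : ustar (\pi_ultrapower x) = \pi_ultrapower (bstar x).
Proof. by apply/pi_eq/ultra_eq_star; exact: ultra_repr. Qed.

Lemma umulA : associative umul.
Proof.
move=> X Y Z; elim/ultrapowerW: X => x.
elim/ultrapowerW: Y => y; elim/ultrapowerW: Z => z.
by rewrite !umul_pi; apply/pi_eq/ultra_eq_ext.
Qed.

Lemma umul1 : left_id uone umul.
Proof.
by move=> X; elim/ultrapowerW: X => x; rewrite umul_pi; apply/pi_eq/ultra_eq_ext.
Qed.

Lemma umulr1 : right_id uone umul.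
Proof.
by move=> X; elim/ultrapowerW: X => x; rewrite umul_pi; apply/pi_eq/ultra_eq_ext.
Qed.

Lemma ustarK : involutive ustar.
Proof.
move=> X; elim/ultrapowerW: X => x; rewrite !ustar_pi; apply/pi_eq/ultra_eq_ext => n u.
by apply: adjK; exact: bseq_in.
Qed.

Lemma ustarM X Y : ustar (umul X Y) = umul (ustar Y) (ustar X).
Proof.
elim/ultrapowerW: X => x; elim/ultrapowerW: Y => y.
rewrite !(umul_pi, ustar_pi); apply/pi_eq/ultra_eq_ext => n u.
by apply: adj_comp; exact: bseq_in.
Qed.

Lemma ustar1 : ustar uone = uone.
Proof.
by rewrite ustar_pi; apply/pi_eq/ultra_eq_ext => n u; exact: adj_id.
Qed.

Definition unitary : pred ultrapower :=
  fun X => (umul (ustar X) X == uone) && (umul X (ustar X) == uone).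

(* U(R^rho) *)
Record unitary_group := Unitary { uval :> ultrapower; _ : unitary uval }.

HB.instance Definition _ := [isSub for uval].
HB.instance Definition _ := [Choice of unitary_group by <:].

Implicit Types U V : unitary_group.

Lemma unitaryVl U : umul (ustar (uval U)) (uval U) = uone.
Proof. by have /andP[/eqP] := valP U. Qed.

Lemma unitaryVr U : umul (uval U) (ustar (uval U)) = uone.
Proof. by have /andP[_ /eqP] := valP U. Qed.

Fact unitary_one : unitary uone.
Proof. by rewrite /unitary ustar1 umul1 eqxx. Qed.

Fact unitary_star U : unitary (ustar (uval U)).
Proof. by rewrite /unitary ustarK unitaryVl unitaryVr eqxx. Qed.

Fact unitary_mul U V : unitary (umul (uval U) (uval V)).
Proof.
rewrite /unitary ustarM -umulA [umul (ustar (uval U)) _]umulA unitaryVl umul1.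
rewrite unitaryVl -umulA [umul (uval V) _]umulA unitaryVr umul1 unitaryVr.
by rewrite eqxx.
Qed.

Definition unitary_g1 := Unitary unitary_one.
Definition unitary_gV U := Unitary (unitary_star U).
Definition unitary_gM U V := Unitary (unitary_mul U V).

Fact unitary_mulA : associative unitary_gM.
Proof. by move=> U V W; apply: val_inj; exact: umulA. Qed.
Fact unitary_mul1g : left_id unitary_g1 unitary_gM.
Proof. by move=> U; apply: val_inj; exact: umul1. Qed.
Fact unitary_mulg1 : right_id unitary_g1 unitary_gM.
Proof. by move=> U; apply: val_inj; exact: umulr1. Qed.
Fact unitary_mulVg : left_inverse unitary_g1 unitary_gV unitary_gM.
Proof. by move=> U; apply: val_inj; exact: unitaryVl. Qed.
Fact unitary_mulgV : right_inverse unitary_g1 unitary_gV unitary_gM.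
Proof. by move=> U; apply: val_inj; exact: unitaryVr. Qed.

HB.instance Definition _ := isGroup.Build unitary_group
  unitary_mulA unitary_mul1g unitary_mulg1 unitary_mulVg unitary_mulgV.

End Ultrapower.

Section Characters.
Context (C : numClosedFieldType) (G : groupType).
Implicit Types phi psi : G -> C.

Definition positive_definite phi :=
  forall n (g : 'I_n -> G) (c : 'I_n -> C),
    0 <= \sum_(i < n) \sum_(j < n) (c i)^* * c j * phi ((g i)^-1 * g j)%g.

Definition Cen : set (G -> C) :=
  [set phi | [/\ positive_definite phi,
                 forall g h : G, phi (g ^ h)%g = phi g &
                 phi 1%g = 1]].

Definition pmul phi psi : G -> C := fun g => phi g * psi g.

Definition punit : G -> C := fun=> 1.

Definition delta_e : G -> C := fun g => (g == 1%g)%:R.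

Definition Hyp (R : hyperfiniteII1 C) : set (G -> C) :=
  [set phi | Cen phi /\
    exists (rho : free_ultrafilter)
           (theta : {multiplicative G -> unitary_group R rho}),
      forall g, utrace (theta g) = phi g].

(* The monoid law on Y is the pointwise product, with unit punit. *)
Definition is_submonoid (X Y : set (G -> C)) :=
  [/\ X `<=` Y, X punit & forall phi psi, X phi -> X psi -> X (pmul phi psi)].

Definition annihilators (X : set (G -> C)) : set (G -> C) :=
  [set phi | X phi /\
    forall psi, X psi -> pmul phi psi = phi /\ pmul psi phi = phi].

Definition closed_under_ultralimits (X : set (G -> C)) :=
  forall (phi : nat -> G -> C) (omega : set_system nat),
    UltraFilter omega -> (forall n, X (phi n)) ->
    (forall g, cvg (phi n g @[n --> omega])) /\
    X (fun g => lim (phi n g @[n --> omega])).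

Definition closed_under_convex_combinations (X : set (G -> C)) :=
  forall n (t : 'I_n -> C) (phi : 'I_n -> G -> C),
    (forall i, 0 <= t i) -> \sum_(i < n) t i = 1 -> (forall i, X (phi i)) ->
    X (fun g => \sum_(i < n) t i * phi i g).

Definition hyperlinear (R : hyperfiniteII1 C) :=
  exists (rho : free_ultrafilter)
         (theta : {multiplicative G -> unitary_group R rho}),
    injective theta.

End Characters.

Arguments Cen C G : clear implicits.
Arguments Hyp {C} G R.
Arguments delta_e {C G}.
Arguments hyperlinear {C} G R.

(* Main.v *)
Require Import Defs.
From HB Require Import structures.
From mathcomp Require Import all_boot all_order all_algebra.
From mathcomp Require Import complex mxtens.
From mathcomp Require Import boolp classical_sets functions cardinality reals.
From mathcomp Require Import topology normedtype sequences.
From mathcomp Require Import ring.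

Set Implicit Arguments.
Unset Strict Implicit.
Unset Printing Implicit Defensive.
Import Order.TTheory GRing.Theory Num.Theory numFieldNormedType.Exports.
Local Open Scope classical_set_scope.
Local Open Scope ring_scope.
Local Open Scope sesquilinear_scope.
Local Open Scope quotient_scope.

(** The elements of Hyp(G) are the limits of normalized traces of asymptotically
    multiplicative maps to finite unitary matrices. Call microstates of phi a net
    of maps W_i from G to unitary matrices of finite size such that tr (W_i g)
    tends to phi g and W_i is asymptotically multiplicative. Then
    [HypP] says that phi is in Hyp(G) if and only if it has microstates, and the
    closure properties become elementary operations on matrices: tensor products
    for pointwise products, block sums with multiplicities for convex
    combinations, and an iteration of the two nets for ultralimits. The
    indices are combined into pairs, and the limit is taken first in the second
    component; this makes the argument work for groups of any cardinality and for
    functions coming from different ultrafilters.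

    From matrices to R ([Hyp_of_microstates]): R is generated by an increasing
    sequence of matrix algebras M_(n k), whose sizes n k are unbounded because R
    is infinite-dimensional ([tdim_large]). A unitary d x d matrix is repeated
    n k / d times along the diagonal and completed by 1's. The trace is perturbed
    by O(d / n k), and the trace of R restricts to the normalized trace since the
    latter is unique ([trace_temb]). A free ultrafilter refining the net of pairs
    (i, k) gives the homomorphism into the unitary group of the ultrapower; its
    trace is automatically in Cen(G) ([Cen_utrace_theta]).

    From R to matrices ([microstates_of_theta]): by the bicommutant theorem the
    union of the M_(n k) is dense in R for the 2-norm ([tower_dense]); this uses
    the orthogonal projection onto a closed subspace. If x in R almost satisfies
    x^* x = 1 and a matrix A is 2-norm close to x, then the unitary part W of its
    polar decomposition is close to A, since
      |A - W|_2 ^ 2 <= |A^* A - 1|_1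
    ([polar_approx], [polar_estimate]), and the right-hand side is controlled by
    |A - x|_2 and |x^* x - 1|_2 without any operator norm estimate.

    Finally delta_e is in Hyp(G) if and only if G is hyperlinear: if theta is
    injective with trace phi, then |(1 + phi) / 2| < 1 outside of e, and the
    powers of (1 + phi) / 2 converge to delta_e. Since delta_e absorbs every phi
    with phi e = 1, it is then the unique annihilator. *)

(** * Unitary matrices and normalized traces *)
Section Matrices.
Context (C : numClosedFieldType).

Definition ntr n (A : 'M[C]_n) : C := \tr A / n%:R.

Lemma adjmxM m n p (A : 'M[C]_(m, n)) (B : 'M[C]_(n, p)) :
  (A *m B)^t* = B^t* *m A^t*.
Proof. by rewrite trmx_mul map_mxM. Qed.

Lemma adjmx1 n : (1%:M : 'M[C]_n)^t* = 1%:M.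
Proof. by rewrite trmx1 map_mx1. Qed.

Lemma unitarymxPC n (U : 'M[C]_n) : U \is unitarymx -> U^t* *m U = 1%:M.
Proof. by move=> /unitarymxP/mulmx1C. Qed.

Lemma unitarymx1 n : (1%:M : 'M[C]_n) \is unitarymx.
Proof. by apply/unitarymxP; rewrite adjmx1 mulmx1. Qed.

Lemma ntr1 n : (0 < n)%N -> ntr (1%:M : 'M[C]_n) = 1.
Proof. by move=> n0; rewrite /ntr mxtrace1 divff// pnatr_eq0 -lt0n. Qed.

Lemma adjmx_tens m n p q (A : 'M[C]_(m, n)) (B : 'M[C]_(p, q)) :
  (A *t B)^t* = A^t* *t B^t*.
Proof. by rewrite trmx_tens map_mxT. Qed.

Lemma tensmx1 m n : (1%:M : 'M[C]_m) *t (1%:M : 'M[C]_n) = 1%:M.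
Proof.
apply/matrixP => i j; case: (mxtens_indexP i) => i0 i1.
case: (mxtens_indexP j) => j0 j1; rewrite tensmxE !mxE -natrM mulnb.
by rewrite (can_eq (@mxtens_indexK m n)) xpair_eqE.
Qed.

Lemma unitarymx_tens m n (A : 'M[C]_m) (B : 'M[C]_n) :
  A \is unitarymx -> B \is unitarymx -> A *t B \is unitarymx.
Proof.
move=> /unitarymxP AU /unitarymxP BU; apply/unitarymxP.
by rewrite adjmx_tens tensmx_mul AU BU tensmx1.
Qed.

Lemma mxtrace_tens m n (A : 'M[C]_m) (B : 'M[C]_n) : \tr (A *t B) = \tr A * \tr B.
Proof.
rewrite /mxtrace mulr_sum.
by apply: eq_bigr => i _; rewrite !mxE.
Qed.

Lemma ntr_tens m n (A : 'M[C]_m) (B : 'M[C]_n) : ntr (A *t B) = ntr A * ntr B.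
Proof. by rewrite /ntr mxtrace_tens natrM invfM mulrACA. Qed.

Lemma adjmx_block m n (A : 'M[C]_m) (B : 'M[C]_n) :
  (block_mx A 0 0 B)^t* = block_mx (A^t*) 0 0 (B^t*).
Proof. by rewrite tr_block_mx map_block_mx !trmx0 !map_mx0. Qed.

Lemma mulmx_block_diag m n (A A' : 'M[C]_m) (B B' : 'M[C]_n) :
  block_mx A 0 0 B *m block_mx A' 0 0 B' = block_mx (A *m A') 0 0 (B *m B').
Proof. by rewrite mulmx_block !mulmx0 !mul0mx !addr0 !add0r. Qed.

Lemma unitarymx_block m n (A : 'M[C]_m) (B : 'M[C]_n) :
  A \is unitarymx -> B \is unitarymx -> block_mx A 0 0 B \is unitarymx.
Proof.
move=> /unitarymxP AU /unitarymxP BU; apply/unitarymxP.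
by rewrite adjmx_block mulmx_block_diag AU BU -scalar_mx_block.
Qed.

Lemma mxtrace_conj_unitary n (P D : 'M[C]_n) : P \is unitarymx ->
  \tr (P^t* *m D *m P) = \tr D.
Proof. by move=> /unitarymxP PU; rewrite mxtrace_mulC mulmxA PU mul1mx. Qed.

(** Take W = A |A|^-1, and for S the sign of A^* A - 1. In an orthonormal basis
    where A^* A is diagonal with entries s_i ^ 2, the left-hand side is the mean
    of the (s_i - 1) ^ 2 and the right-hand side that of the |s_i ^ 2 - 1|, which
    is the normalized trace norm of A^* A - 1. *)
Lemma polar_approx n (A : 'M[C]_n) : A \in unitmx ->
  exists W S : 'M[C]_n, [/\ W \is unitarymx, S \is unitarymx &
    ntr ((A - W)^t* *m (A - W)) <= ntr ((A^t* *m A - 1%:M) *m S)].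
Proof.
move=> Aunit; set B := A^t* *m A.
have Bnormal : B \is normalmx.
  by apply/normalmxP; rewrite /B adjmxM trmxCK.
pose P := spectralmx B; pose d := spectral_diag B.
have PU : P \is unitarymx by exact: spectral_unitarymx.
have PPt : P *m P^t* = 1%:M by exact/unitarymxP.
have PtP := unitarymxPC PU.
have BE : B = P^t* *m diag_mx d *m P.
  by rewrite -invmx_unitary//; exact/orthomx_spectralP.
have dE : diag_mx d = (A *m P^t*)^t* *m (A *m P^t*).
  rewrite adjmxM trmxCK -mulmxA (mulmxA (A^t*)) -/B BE.
  by rewrite -!mulmxA PPt mulmx1 mulmxA PPt mul1mx.
have d_ge0 i : 0 <= d 0 i.
  have /matrixP/(_ i i) := dE; rewrite mxE eqxx mulr1n => ->.
  by rewrite mxE sumr_ge0// => k _; rewrite !mxE mulrC mul_conjC_ge0.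
have d_gt0 i : 0 < d 0 i.
  rewrite lt_def d_ge0 andbT.
  have : diag_mx d \in unitmx.
    rewrite dE unitmx_mul map_unitmx unitmx_tr andbb.
    by rewrite unitmx_mul Aunit map_unitmx unitmx_tr spectral_unit.
  by rewrite unitmxE det_diag unitfE => /prodf_neq0; exact.
(* conjP is the functional calculus of B: conjP d = B, and W and S are defined
   through conjP of suitable functions of the eigenvalues. *)
pose conjP (v : 'rV[C]_n) := P^t* *m diag_mx v *m P.
have conjPM v w : conjP v *m conjP w = conjP (\row_i (v 0 i * w 0 i)).
  rewrite /conjP -!mulmxA (mulmxA P) PPt mul1mx; congr (_ *m _); rewrite !mulmxA.
  by rewrite mulmx_diag; congr (diag_mx _ *m _); apply/rowP => i; rewrite !mxE.
have conjPt v : (conjP v)^t* = conjP (map_mx Num.conj v).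
  by rewrite /conjP !adjmxM trmxCK mulmxA tr_diag_mx map_diag_mx.
have conjP1 : conjP (const_mx 1) = 1%:M.
  by rewrite /conjP diag_const_mx mulmx1 PtP.
have conjPB v w : conjP v - conjP w = conjP (v - w).
  by rewrite /conjP linearB /= mulmxBr mulmxBl.
have tr_conjP v : \tr (conjP v) = \sum_i v 0 i.
  by rewrite mxtrace_conj_unitary// mxtrace_diag.
pose s : 'rV[C]_n := map_mx sqrtC d.
pose sV : 'rV[C]_n := map_mx (fun x => (sqrtC x)^-1) d.
pose sg : 'rV[C]_n := map_mx (fun x => if 1 <= x then 1 else -1) d.
have s_gt0 i : 0 < s 0 i by rewrite mxE sqrtC_gt0.
have sVs : \row_i (sV 0 i * s 0 i) = const_mx 1.
  by apply/rowP => i; rewrite !mxE mulVf// sqrtC_eq0 gt_eqF.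
pose W := A *m conjP sV; pose S := conjP sg.
have AE : A = W *m conjP s by rewrite /W -mulmxA conjPM sVs conjP1 mulmx1.
have sVr : map_mx Num.conj sV = sV.
  apply/rowP => i; rewrite !mxE; apply/CrealP.
  by rewrite realV gtr0_real// sqrtC_gt0.
have WtW : W^t* *m W = 1%:M.
  rewrite /W adjmxM -mulmxA (mulmxA (A^t*)) -/B BE -/(conjP d) conjPt sVr !conjPM.
  rewrite -conjP1; congr conjP; apply/rowP => i; rewrite !mxE.
  have : sqrtC (d 0 i) != 0 by rewrite sqrtC_eq0 gt_eqF.
  by move: (sqrtCK (d 0 i)); move: (sqrtC _) => t <- t0; field.
have WU : W \is unitarymx by apply/unitarymxP/mulmx1C.
exists W, S; split => //.
  apply/unitarymxP/mulmx1C; rewrite conjPt conjPM -conjP1; congr conjP.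
  apply/rowP => i; rewrite !mxE.
  by case: ifP => _; rewrite ?(rmorph1, mulr1)// rmorphN1 mulrNN mulr1.
have AW : A - W = W *m conjP (s - const_mx 1).
  by rewrite -conjPB conjP1 mulmxBr -AE mulmx1.
rewrite /ntr ler_wpM2r ?invr_ge0 ?ler0n// AW adjmxM -mulmxA (mulmxA (W^t*)) WtW.
rewrite mul1mx conjPt conjPM -/B BE -/(conjP d) -{1}conjP1 conjPB conjPM.
rewrite !tr_conjP ler_sum// => i _; rewrite !mxE.
have d1 : d 0 i \is Num.real by rewrite gtr0_real.
have := s_gt0 i; rewrite mxE; set t := sqrtC _ => t0.
have tr : t \is Num.real by rewrite gtr0_real.
have -> : d 0 i = t ^+ 2 by rewrite sqrtCK.
rewrite (CrealP _); last by rewrite realB.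
have -> : (1 <= t ^+ 2) = (1 <= t).
  by rewrite -[1 in LHS](expr1n _ 2) ler_pXn2r// ?nnegrE// ltW.
have -> : t ^+ 2 - 1 = (t - 1) * (t + 1) by ring.
have tt : t - 1 <= t + 1 by rewrite lerD2l -subr_ge0 opprK addr_ge0.
have [t1|t1] := real_leP (real1 C) tr.
  by rewrite mulr1 ler_wpM2l// subr_ge0.
rewrite mulrN1 -mulNr opprB -[X in X <= _]mulrNN !opprB ler_wpM2l ?subr_ge0 ?(ltW t1)//.
by rewrite addrC lerD2r (le_trans _ (ltW t0))// oppr_le0 ltW.
Qed.

End Matrices.

(** * Iterated limits *)
Section IteratedFilter.
Context (I : Type) (J : I -> Type) (F : set_system I).
Context (G : forall i, set_system (J i)).

(** The Fubini sum of the filters G i along F: how far j has to be taken along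
    G i may depend on i. *)
Definition iterated : set_system {i : I & J i} :=
  [set A | \forall i \near F, \forall j \near @G i, A (existT _ i j)].

Lemma iterated_filter {FF : ProperFilter F} {GF : forall i, ProperFilter (@G i)} :
  ProperFilter iterated.
Proof.
have FI : Filter iterated.
  split.
  - by rewrite /iterated /=; apply: nearW => i; apply: nearW.
  - by move=> A B; apply: (@filterS2 _ F _) => i; exact: filterI.
  - by move=> A B AB; apply: (@filterS _ F _) => i; apply: filterS => j; exact: AB.
apply: Build_ProperFilter_ex => A FA; have [i Gi] := @filter_ex _ F _ _ FA.
by have [j Aij] := filter_ex Gi; exists (existT _ i j).
Qed.

Lemma cvg_iterated (C : numFieldType) {FF : ProperFilter F}
    {GF : forall i, ProperFilter (@G i)} (f : {i : I & J i} -> C) (a : I -> C) (l : C) :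
  (forall i, f (existT _ i j) @[j --> @G i] --> a i) -> a @ F --> l ->
  f @ iterated --> l.
Proof.
move=> fa al; have FI := iterated_filter.
apply/cvgrPdist_lt => e e0; have e20 : 0 < e / 2 by rewrite divr_gt0.
move/cvgrPdist_lt/(_ _ e20) : al; apply: filterS => i ail.
move/cvgrPdist_lt/(_ _ e20) : (fa i); apply: filterS => j faij.
rewrite [e](splitr e) -[l - _](subrKA (a i)).
by rewrite (le_lt_trans (ler_normD _ _))// ltrD.
Qed.

End IteratedFilter.

(** * Microstates and their closure properties *)
Section Microstates.
Context (C : numClosedFieldType) (G : groupType).
Implicit Types phi psi : G -> C.

(** For unitary U and V, the 2-norm satisfies |U - V|_2 ^ 2 = 2 - 2 Re tr (U^* V).
    Expressing asymptotic multiplicativity by the trace of U^* V makes it pass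
    to tensor products and block sums without estimates. *)
Record microstates phi := Microstates {
  ms_index : countType;
  ms_filter : set_system ms_index;
  ms_proper : ProperFilter ms_filter;
  ms_dim : ms_index -> nat;
  ms_dim_gt0 : forall i, (0 < ms_dim i)%N;
  ms_mx : forall i, G -> 'M[C]_(ms_dim i);
  ms_unitary : forall i g, ms_mx i g \is unitarymx;
  ms_tr : forall g, ntr (ms_mx i g) @[i --> ms_filter] --> phi g;
  ms_mul : forall g h,
    ntr ((ms_mx i (g * h)%g)^t* *m (ms_mx i g *m ms_mx i h))
      @[i --> ms_filter] --> (1 : C)
}.

Arguments ms_filter {phi} m.
Arguments ms_tr {phi} m g.
Arguments ms_mul {phi} m g h.
#[local] Existing Instance ms_proper.
#[local] Existing Instance iterated_filter.

Lemma microstates_punit : microstates (punit C (G := G)).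
Proof.
apply: (@Microstates _ unit (principal_filter tt)
  (principal_filter_proper tt) (fun=> 1%N) _ (fun _ _ => 1%:M)).
- by [].
- by move=> _ _; exact: unitarymx1.
- by move=> g; rewrite ntr1//; exact: cvg_cst.
- by move=> g h; rewrite adjmx1 !mulmx1 ntr1//; exact: cvg_cst.
Qed.

Lemma microstates_pmul phi psi :
  microstates phi -> microstates psi -> microstates (pmul phi psi).
Proof.
move=> M N.
pose W (k : {i : ms_index M & ms_index N}) g := ms_mx (tag k) g *t ms_mx (tagged k) g.
pose I : countType := {i : ms_index M & ms_index N}.
pose F : set_system I := iterated (ms_filter M) (fun=> ms_filter N).
have FF : ProperFilter F by exact: iterated_filter.
apply: (@Microstates _ I F FF _ _ W) => [k|k g|g|g h].
- by rewrite muln_gt0 !ms_dim_gt0.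
- by apply: unitarymx_tens; exact: ms_unitary.
- apply: (@cvg_iterated _ _ _ _ _ _ _ _ (fun i => ntr (ms_mx i g) * psi g)).
    move=> i; under eq_fun do rewrite ntr_tens.
    by apply: cvgM; [exact: cvg_cst|exact: ms_tr].
  by apply: cvgM; [exact: ms_tr|exact: cvg_cst].
- pose m (L : {phi & microstates phi}) (i : ms_index (projT2 L)) := ntr
    ((ms_mx i (g * h)%g)^t* *m (ms_mx i g *m ms_mx i h)).
  have ntrW k : ntr ((W k (g * h)%g)^t* *m (W k g *m W k h)) =
      m (existT _ _ M) (tag k) * m (existT _ _ N) (tagged k).
    by rewrite /W adjmx_tens !tensmx_mul ntr_tens.
  under eq_fun do rewrite ntrW.
  apply: (@cvg_iterated _ _ _ _ _ _ _ _ (m (existT _ _ M))).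
    move=> i; rewrite -[X in _ --> X]mulr1.
    by apply: cvgM; [exact: cvg_cst|exact: ms_mul].
  exact: ms_mul.
Qed.

Lemma microstates_lim (omega : set_system nat) {FF : ProperFilter omega}
    (phi : nat -> G -> C) psi :
  (forall n, microstates (phi n)) ->
  (forall g, phi n g @[n --> omega] --> psi g) -> microstates psi.
Proof.
move=> M phipsi.
pose W (k : {n : nat & ms_index (M n)}) g := ms_mx (tagged k) g.
pose I : countType := {n : nat & ms_index (M n)}.
pose F : set_system I := iterated omega (fun n => ms_filter (M n)).
have FI : ProperFilter F by exact: iterated_filter.
apply: (@Microstates _ I F FI _ _ W) => [k|k g|g|g h].
- exact: ms_dim_gt0.
- exact: ms_unitary.
- apply: (@cvg_iterated _ _ _ _ _ _ _ _ (phi^~ g)) => // n; exact: ms_tr.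
- apply: (@cvg_iterated _ _ _ _ _ _ _ _ (fun=> 1)); last exact: cvg_cst.
  move=> n; exact: ms_mul.
Qed.

(** The tensor factors give the two blocks sizes m n a and m n b, so that the
    normalized trace weights A and B by a / (a + b) and b / (a + b) whatever
    m and n are. *)
Definition amplify m n a b (A : 'M[C]_m) (B : 'M[C]_n) :
    'M[C]_(m * n * a + m * n * b) :=
  block_mx ((A *t (1%:M : 'M_n)) *t (1%:M : 'M_a)) 0
    0 (((1%:M : 'M_m) *t B) *t (1%:M : 'M_b)).

Lemma adj_amplify m n a b (A : 'M[C]_m) (B : 'M[C]_n) :
  (amplify a b A B)^t* = amplify a b (A^t*) (B^t*).
Proof. by rewrite /amplify adjmx_block !adjmx_tens !adjmx1. Qed.

Lemma amplifyM m n a b (A A' : 'M[C]_m) (B B' : 'M[C]_n) :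
  amplify a b A B *m amplify a b A' B' = amplify a b (A *m A') (B *m B').
Proof. by rewrite /amplify mulmx_block_diag !tensmx_mul !mulmx1. Qed.

Lemma amplify_unitary m n a b (A : 'M[C]_m) (B : 'M[C]_n) :
  A \is unitarymx -> B \is unitarymx -> amplify a b A B \is unitarymx.
Proof.
by move=> AU BU; rewrite unitarymx_block ?unitarymx_tens ?unitarymx1.
Qed.

Lemma ntr_amplify m n a b (A : 'M[C]_m) (B : 'M[C]_n) :
  (0 < m)%N -> (0 < n)%N -> (0 < a + b)%N -> let t := a%:R / (a + b)%:R in
  ntr (amplify a b A B) = t * ntr A + (1 - t) * ntr B.
Proof.
move=> m0 n0 ab0 t; rewrite /ntr mxtrace_block !mxtrace_tens !mxtrace1 /t.
rewrite -mulnDr !natrM !natrD; field.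
by rewrite -natrD !pnatr_eq0 -!lt0n ab0 m0 n0.
Qed.

Lemma microstates_convex phi psi (a b : nat -> nat) (t : C) :
  (forall n, 0 < a n + b n)%N ->
  (a n)%:R / (a n + b n)%:R @[n --> \oo] --> t ->
  microstates phi -> microstates psi ->
  microstates (fun g => t * phi g + (1 - t) * psi g).
Proof.
move=> ab0 abt M N.
pose J := {_ : ms_index N & nat}.
pose FJ := iterated (ms_filter N) (fun=> \oo : set_system nat).
pose W (k : {i : ms_index M & J}) g :=
  amplify (a (tagged (tagged k))) (b (tagged (tagged k))) (ms_mx (tag k) g)
    (ms_mx (tag (tagged k)) g).
pose r n : C := (a n)%:R / (a n + b n)%:R.
have rt : r @ \oo --> t by exact: abt.
have cvgW (f : ms_index M -> C) (f' : ms_index N -> C) (l l' : C) :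
    f @ ms_filter M --> l -> f' @ ms_filter N --> l' ->
    (fun k : {i : ms_index M & J} =>
      r (tagged (tagged k)) * f (tag k)
      + (1 - r (tagged (tagged k))) * f' (tag (tagged k)))
    @ iterated (ms_filter M) (fun=> FJ) --> t * l + (1 - t) * l'.
  move=> fl fl'.
  have FJP : ProperFilter FJ by exact: iterated_filter.
  apply: (@cvg_iterated _ _ _ _ _ _ _ _ (fun i => t * f i + (1 - t) * l')).
    move=> i; apply: (@cvg_iterated _ _ _ _ _ _ _ _
        (fun j => t * f i + (1 - t) * f' j)) => [j|].
      have r1 : (fun n => 1 - r n) @ \oo --> 1 - t.
        exact: (cvgB (cvg_cst _) rt).
      exact: (cvgD (cvgM rt (cvg_cst (f i))) (cvgM r1 (cvg_cst (f' j)))).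
    exact: (cvgD (cvg_cst (t * f i)) (cvgM (cvg_cst (1 - t)) fl')).
  exact: (cvgD (cvgM (cvg_cst t) fl) (cvg_cst ((1 - t) * l'))).
pose I : countType := {i : ms_index M & J}.
pose F : set_system I := iterated (ms_filter M) (fun=> FJ).
have FF : ProperFilter F by exact: iterated_filter.
apply: (@Microstates _ I F FF _ _ W) => [k|k g|g|g h].
- by rewrite -mulnDr !muln_gt0 !ms_dim_gt0 ab0.
- by apply: amplify_unitary; exact: ms_unitary.
- under eq_fun do rewrite ntr_amplify ?ms_dim_gt0//.
  exact: (cvgW _ _ _ _ (ms_tr M g) (ms_tr N g)).
- under eq_fun do rewrite adj_amplify !amplifyM ntr_amplify ?ms_dim_gt0//.
  have t1 : t * 1 + (1 - t) * 1 = 1 by ring.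
  by have := cvgW _ _ _ _ (ms_mul M g h) (ms_mul N g h); rewrite t1.
Qed.

End Microstates.

Arguments ms_filter {C G phi} m.
Arguments ms_tr {C G phi} m g.
Arguments ms_mul {C G phi} m g h.

(** * Hilbert spaces: orthogonal projections and the bicommutant *)
Section Hilbert.
Context (C : numClosedFieldType) (H : hilbert C).
Implicit Types (u v w : H) (S : set H).

Lemma hilbert_normD u v : let d := dot u v in
  `|u + v| ^+ 2 = `|u| ^+ 2 + `|v| ^+ 2 + (d + d^*).
Proof. by rewrite /= !dot_norm dnormD. Qed.

Lemma hilbert_normB u v : let d := dot u v in
  `|u - v| ^+ 2 = `|u| ^+ 2 + `|v| ^+ 2 - (d + d^*).
Proof. by rewrite /= !dot_norm dnormB. Qed.

Lemma parallelogram u v :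
  `|u - v| ^+ 2 = 2 * `|u| ^+ 2 + 2 * `|v| ^+ 2 - `|u + v| ^+ 2.
Proof. by rewrite hilbert_normB (hilbert_normD u v); ring. Qed.

Lemma dotDl u v w : dot (u + v) w = dot u w + dot v w.
Proof. by rewrite linearDl. Qed.

Lemma dotBl u v w : dot (u - v) w = dot u w - dot v w.
Proof. by rewrite linearBl. Qed.

Lemma dotBr u v w : dot u (v - w) = dot u v - dot u w.
Proof. by rewrite linearBr. Qed.

Lemma dotZl (a : C) u w : dot (a *: u) w = a * dot u w.
Proof. by rewrite linearZl_LR. Qed.

Lemma dotZr (a : C) u w : dot u (a *: w) = a^* * dot u w.
Proof. by rewrite linearZr_LR. Qed.

Lemma dot_suml (J : finType) (F : J -> H) w :
  dot (\sum_j F j) w = \sum_j dot (F j) w.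
Proof. by rewrite linear_sumlz. Qed.

Lemma dot_sumr (J : finType) (F : J -> H) w :
  dot w (\sum_j F j) = \sum_j dot w (F j).
Proof. by rewrite linear_sumr. Qed.

Lemma hnorm_eq0 u : dot u u = 0 -> u = 0.
Proof. by rewrite -dot_norm => /eqP; rewrite sqrf_eq0 normr_eq0 => /eqP. Qed.

Lemma hilbert_ext u v : (forall w, dot u w = dot v w) -> u = v.
Proof.
move=> uv; apply/eqP; rewrite -subr_eq0; apply/eqP/hnorm_eq0.
by rewrite dotBl uv subrr.
Qed.

Lemma cauchy_schwarz u v : `|dot u v| <= `|u| * `|v|.
Proof.
have [->|v0] := eqVneq v 0.
  by rewrite linear0r !normr0 mulr0.
rewrite -(@ler_pXn2r _ 2) ?nnegrE ?mulr_ge0// exprMn.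
have v2 : 0 < `|v| ^+ 2 by rewrite exprn_gt0// normr_gt0.
have vr : (`|v| ^+ 2)^* = `|v| ^+ 2 by apply/CrealP; rewrite realX// normr_real.
have : 0 <= `| `|v| ^+ 2 *: u - dot u v *: v| ^+ 2 by rewrite exprn_ge0.
rewrite (dot_norm (_ - _)) dotBl !dotBr !dotZl !dotZr vr -!dot_norm (dotC v u) normCK.
set d := dot u v; set a := `|v| ^+ 2 in vr v2 *; set b := `|u| ^+ 2.
have -> : a * (a * b) - a * (d^* * d) - (d * (a * d^*) - d * (d^* * a))
  = a * (b * a - d * d^*) by ring.
by rewrite pmulr_rge0// subr_ge0.
Qed.

Definition in_closure S u := forall e : C, 0 < e -> exists2 s, S s & `|u - s| < e.

Definition linear_subspace S := S 0 /\ forall (a : C) u v, S u -> S v -> S (a *: u + v).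

Lemma linear_subspaceB S u v : linear_subspace S -> S u -> S v -> S (u - v).
Proof. by move=> [_ SS] Su Sv; rewrite addrC -scaleN1r; exact: SS. Qed.

Lemma in_closureB S u v : linear_subspace S ->
  in_closure S u -> in_closure S v -> in_closure S (u - v).
Proof.
move=> SS Su Sv e e0; have e20 : 0 < e / 2 by rewrite divr_gt0.
have [s Ss us] := Su _ e20; have [t St vt] := Sv _ e20.
exists (s - t); first exact: linear_subspaceB.
have -> : u - v - (s - t) = (u - s) - (v - t).
  by rewrite !opprB addrACA [RHS]addrACA [- v + _]addrC [- s + _]addrC.
by rewrite [e](splitr e) (le_lt_trans (ler_normB _ _))// ltrD.
Qed.

Lemma orth_in_closure S p v : in_closure S p -> (forall s, S s -> dot v s = 0) ->
  dot v p = 0.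
Proof.
move=> Sp vS; apply/eqP; rewrite -normr_le0; apply/ler_addgt0Pr => e e0.
have k0 : 0 < `|v| + 1 by rewrite ltr_wpDl.
have [s Ss ps] := Sp _ (divr_gt0 e0 k0).
have -> : dot v p = dot v (p - s) by rewrite dotBr (vS s Ss) subr0.
rewrite add0r (le_trans (cauchy_schwarz _ _))//.
rewrite (@le_trans _ _ ((`|v| + 1) * `|p - s|))//.
  by rewrite ler_wpM2r// lerDl.
by rewrite mulrC -ler_pdivlMr// ltW.
Qed.

Lemma in_closure_orth_eq0 S u :
  in_closure S u -> (forall s, S s -> dot u s = 0) -> u = 0.
Proof. by move=> Su uS; apply/hnorm_eq0/(orth_in_closure Su uS). Qed.

(** If t almost minimizes the distance from u to S, then u - t is almost
    orthogonal to S: compare t with t + (k / |s| ^ 2) s, k = <u - t, s>, which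
    lowers the squared distance by |k| ^ 2 / |s| ^ 2. *)
Lemma orthogonal_of_min S (m d : C) u t s : linear_subspace S -> S t -> S s ->
  (forall s, S s -> m <= `|u - s| ^+ 2) -> `|u - t| ^+ 2 < m + d ->
  `|dot (u - t) s| ^+ 2 <= d * `|s| ^+ 2.
Proof.
move=> [S0 SS] St Ss Sm utd; have d0 : 0 <= d.
  by rewrite -(lerD2l m) addr0 (le_trans (Sm t St))// ltW.
have [->|s0] := eqVneq s 0; first by rewrite linear0r !normr0 !expr0n/= mulr0.
have s2 : 0 < `|s| ^+ 2 by rewrite exprn_gt0// normr_gt0.
set k := dot (u - t) s; set n := `|s| ^+ 2 in s2 *.
have nr : n^* = n by apply/CrealP; rewrite realX// normr_real.
have := Sm _ (SS (k / n) s t Ss St).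
rewrite [_ *: _ + t]addrC opprD addrA hilbert_normB dotZr -/k.
have -> : `|k / n *: s| ^+ 2 = `|k| ^+ 2 / n.
  rewrite normrZ exprMn -/n normrM exprMn normfV (ger0_norm (ltW s2)).
  by field; rewrite gt_eqF.
have -> : (k / n)^* * k = `|k| ^+ 2 / n.
  by rewrite normCK rmorphM fmorphV /= nr; ring.
have -> : (`|k| ^+ 2 / n)^* = `|k| ^+ 2 / n.
  by apply/CrealP; rewrite realM ?realV ?realX ?normr_real// gtr0_real.
rewrite opprD addrA addrK => /le_lt_trans /(_ (_ : _ < m + d - `|k| ^+ 2 / n)).
rewrite ltrD2r => /(_ utd); rewrite -addrA -[X in X < _]addr0 ltrD2l subr_gt0.
by rewrite ltr_pdivrMr// => /ltW.
Qed.

End Hilbert.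

Section Projection.
Context (K : realType) (H : hilbert K[i]).
Local Notation C := K[i].
Implicit Types (u v w : H) (S : set H).

(** The order of C is only partial, so the infimum is taken among the reals. *)
Lemma nonneg_inf T (S : set T) (f : T -> C) : S !=set0 ->
  (forall s, S s -> 0 <= f s) ->
  exists m, (forall s, S s -> m <= f s) /\
    forall e, 0 < e -> exists2 s, S s & f s < m + e.
Proof.
move=> [s0 Ss0] f0.
have fE s : S s -> f s = (complex.Re (f s))%:C%C.
  by move=> /f0/ger0_real/complex_realP[x ->].
pose E := [set complex.Re (f s) | s in S].
have hiE : has_inf E.
  split; first by exists (complex.Re (f s0)), s0.
  by exists 0 => _ [s Ss <-]; move: (f0 s Ss); rewrite {1}(fE s Ss) ler0c.
exists (inf E)%:C%C; split=> [s Ss|e e0].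
  by rewrite (fE s Ss) lecR; apply: ge_inf; [exact: hiE.2|exists s].
have /complex_realP[r er] := gtr0_real e0.
have r0 : 0 < r by move: e0; rewrite er (ltcR 0).
have [_ [s Ss <-] sE] := inf_adherent r0 hiE; exists s => //.
by rewrite (fE s Ss) er -rmorphD/= ltcR.
Qed.

(** The elements of S that almost minimize the distance to u generate a Cauchy
    filter, by the parallelogram identity; p is its limit. *)
Lemma orthogonal_proj S u : linear_subspace S ->
  exists p, in_closure S p /\ forall s, S s -> dot (u - p) s = 0.
Proof.
move=> SS; have [S0 SZD] := SS.
have [m [Sm mS]] : exists m, (forall s, S s -> m <= `|u - s| ^+ 2) /\
    forall e, 0 < e -> exists2 s, S s & `|u - s| ^+ 2 < m + e.
  by apply: nonneg_inf => [|s _]; [exists 0|rewrite exprn_ge0].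
pose D (e : C) := [set s | S s /\ `|u - s| ^+ 2 < m + e].
pose F := filter_from [set e : C | 0 < e] D.
have FF : ProperFilter F.
  apply: filter_from_proper => [|e /mS[s Ss sm]]; last by exists s.
  apply: filter_from_filter; first by exists 1 => /=.
  move=> a b /= a0 b0; have /orP[ab|ba] := real_leVge (gtr0_real a0) (gtr0_real b0).
    by exists a => // s [Ss sa]; do 2!split=> //; rewrite (lt_le_trans sa)// lerD2l.
  by exists b => // s [Ss sa]; do 2!split=> //; rewrite (lt_le_trans sa)// lerD2l.
(* The midpoint of s and t is in S, hence at squared distance at least m. *)
have close (e : C) s t : D e s -> D e t -> `|s - t| ^+ 2 <= 4 * e.
  move=> [Ss us] [St ut].
  have mid : 4 * m <= `|(u - s) + (u - t)| ^+ 2.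
    have -> : (u - s) + (u - t) = 2 *: (u - (2^-1 *: s + (2^-1 *: t + 0))).
      rewrite addr0 scalerBr scalerDr !scalerA.
      rewrite mulfV ?pnatr_eq0// !scale1r scaler_nat mulr2n.
      by rewrite opprD addrACA.
    rewrite normrZ exprMn (_ : `|2| ^+ 2 = 4); last by rewrite normr_nat -natrX.
    by rewrite ler_pM2l// Sm//; exact: SZD _ _ _ Ss (SZD _ _ _ St S0).
  have -> : s - t = (u - t) - (u - s) by rewrite opprB [RHS]addrC addrA subrK.
  rewrite parallelogram [_ - t + _]addrC lerBlDr.
  rewrite (le_trans _ (lerD (lexx _) mid))//.
  have -> : 4 * e + 4 * m = 2 * (m + e) + 2 * (m + e) by ring.
  by rewrite lerD// ler_pM2l// ltW.
have Fcvg : cvg F.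
  apply: cauchy_cvg; apply: cauchy_exP => e e0.
  have d0 : 0 < e ^+ 2 / 8 by rewrite divr_gt0// exprn_gt0.
  have [s Ss us] := mS _ d0; exists s.
  exists (e ^+ 2 / 8) => //= t Dt; rewrite -ball_normE /=.
  have := close _ _ _ (conj Ss us : D _ s) Dt.
  rewrite -(@ltr_pXn2r _ 2) ?nnegrE ?(ltW e0)// => /le_lt_trans; apply.
  have -> : 4 * (e ^+ 2 / 8) = e ^+ 2 / 2 by field.
  by rewrite ltr_pdivrMr// ltr_pMr ?exprn_gt0// ltr1n.
have near_p (e d : C) : 0 < e -> 0 < d ->
    exists2 s, S s /\ `|u - s| ^+ 2 < m + d & `|lim F - s| < e.
  move=> e0 d0; have Fe : F (ball (lim F) e) by apply: Fcvg; exact: nbhsx_ballx.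
  have Fd : F (D d) by exists d.
  have [s [Fs [Ss us]]] := filter_ex (filterI Fe Fd); exists s => //.
  by move: Fs; rewrite -ball_normE.
exists (lim F); split=> [e e0|s Ss].
  by have [s [Ss _] ls] := near_p e 1 e0 ltr01; exists s.
apply/eqP; rewrite -normr_le0; apply/ler_addgt0Pr => e e0; rewrite add0r.
pose k := `|s| + 1; have k0 : 0 < k by rewrite ltr_wpDl.
have e20 : 0 < e / 2 by rewrite divr_gt0.
have ek0 : 0 < e / 2 / k by rewrite divr_gt0.
have [t [St ut] lt] := near_p _ _ ek0 (exprn_gt0 2 ek0).
have -> : u - lim F = (u - t) - (lim F - t) by rewrite opprB addrA subrK.
have sk : `|s| <= k by rewrite lerDl.
rewrite dotBl (le_trans (ler_normB _ _))// [e](splitr e) lerD//.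
  rewrite -(@ler_pXn2r _ 2) ?nnegrE// ?(ltW e20)//.
  rewrite (le_trans (orthogonal_of_min SS St Ss Sm ut))//.
  rewrite -exprMn ler_pXn2r ?nnegrE ?(mulr_ge0 (ltW ek0) (normr_ge0 s)) ?(ltW e20)//.
  by rewrite mulrAC ler_pdivrMr// ler_wpM2l// ltW.
rewrite (le_trans (cauchy_schwarz _ _))// (le_trans (ler_wpM2r _ (ltW lt)))//.
by rewrite mulrAC ler_pdivrMr// ler_wpM2l// ltW.
Qed.

(** The easy half of the bicommutant theorem: the orthogonal projection p onto
    the closure of the invariant subspace S commutes with A, hence with x, so
    x s = x (p s) = p (x s). *)
Lemma bicommutant_in_closure (A : set (H -> H)) S x s : linear_subspace S ->
  (forall a, A a -> bounded_op a /\ exists2 b, A b & adjoint_of a b) ->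
  (forall a s, A a -> S s -> S (a s)) ->
  commutant (commutant A) x -> S s -> in_closure S (x s).
Proof.
move=> SS Aop AS Ax Ss; have [p pP] := choice (fun u => orthogonal_proj u SS).
have p_unique u q : in_closure S q -> (forall s, S s -> dot (u - q) s = 0) ->
    p u = q.
  have [Sp up] := pP u; move=> Sq uq; apply/eqP; rewrite -subr_eq0; apply/eqP.
  apply: (in_closure_orth_eq0 (in_closureB SS Sp Sq)) => t St.
  have -> : p u - q = (u - q) - (u - p u) by rewrite opprB [RHS]addrC addrA subrK.
  by rewrite dotBl uq// up// subrr.
have in_closure_lin (a : K[i]) u v : in_closure S u -> in_closure S v ->
    in_closure S (a *: u + v).
  move=> Su Sv; rewrite -[v]opprK; apply: in_closureB => //; last first.
    rewrite -[- v]add0r; apply: in_closureB => // e e0; exists 0; first exact: SS.1.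
    by rewrite subrr normr0.
  move=> e e0; have k0 : 0 < `|a| + 1 by rewrite ltr_wpDl.
  have [t St ut] := Su _ (divr_gt0 e0 k0).
  exists (a *: t); first by rewrite -[a *: t]addr0; apply: SS.2 => //; exact: SS.1.
  rewrite -scalerBr normrZ (@le_lt_trans _ _ ((`|a| + 1) * `|u - t|))//.
    by rewrite ler_wpM2r// lerDl.
  by rewrite mulrC -ltr_pdivlMr.
have pL : linear p.
  move=> a u v; apply: p_unique; first exact: in_closure_lin (pP u).1 (pP v).1.
  move=> t St; have -> : a *: u + v - (a *: p u + p v)
      = a *: (u - p u) + (v - p v) by rewrite scalerBr opprD addrACA.
  by rewrite linearDl /= dotZl (pP u).2// (pP v).2// mulr0 addr0.
have pB : bounded_op p.
  split=> //; exists 1 => u; rewrite mul1r -(@ler_pXn2r _ 2) ?nnegrE//.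
  have [Sp up] := pP u; have d0 := orth_in_closure Sp up.
  rewrite -[u in X in _ <= X](subrK (p u)) hilbert_normD d0 conjC0 !addr0.
  by rewrite lerDr exprn_ge0.
have pA : commutant A p.
  split=> // a Aa; have [[aL [c ac]] [b Ab ab]] := Aop a Aa.
  have aB u v : a (u - v) = a u - a v.
    by rewrite addrC -scaleN1r aL scaleN1r addrC.
  apply/funext => u /=; apply/esym/p_unique => [e e0|t St].
    have k0 : 0 < `|c| + 1 by rewrite ltr_wpDl.
    have [t St ut] := (pP u).1 _ (divr_gt0 e0 k0).
    exists (a t); first exact: AS.
    rewrite -aB (le_lt_trans (ac _))//.
    rewrite (@le_lt_trans _ _ ((`|c| + 1) * `|p u - t|))//; last first.
      by rewrite mulrC -ltr_pdivlMr.
    have cn : 0 <= c * `|p u - t| := le_trans (normr_ge0 _) (ac _).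
    rewrite -(ger0_norm cn) normrM normr_id ler_wpM2r// lerDl//.
  by rewrite -aB ab (pP u).2//; exact: AS.
have ps : p s = s.
  apply: p_unique => [e e0|t _]; first by exists s => //; rewrite subrr normr0.
  by rewrite subrr linear0l.
have /(congr1 (@^~ s)) /= := Ax.2 p pA.
by rewrite ps => <-; exact: (pP _).1.
Qed.

End Projection.

(** * Matrix algebras acting on a Hilbert space *)
Section TraceUnique.
Context (C : numClosedFieldType).

(** A tracial functional kills e_ij = e_ii e_ij for i != j, and takes the same
    value at e_ii = e_ij e_ji and e_jj = e_ji e_ij. *)
Lemma trace_unique n (t : 'M[C]_n -> C) :
  (forall a P Q, t (a *: P + Q) = a * t P + t Q) ->
  (forall P Q, t (P *m Q) = t (Q *m P)) -> t 1%:M = 1 -> forall P, t P = ntr P.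
Proof.
move=> tL tC t1 P.
have t0 : t 0 = 0.
  by have := tL (-1) 0 0; rewrite scaler0 addr0 mulN1r addNr.
have tsum (J : finType) (F : J -> 'M[C]_n) : t (\sum_j F j) = \sum_j t (F j).
  apply: (big_morph t _ t0) => A B.
  by rewrite -[A in LHS]scale1r tL mul1r.
have tZ a Q : t (a *: Q) = a * t Q by rewrite -[a *: Q]addr0 tL t0 addr0.
pose e (i j : 'I_n) : 'M[C]_n := delta_mx i j.
have eij i j : i != j -> t (e i j) = 0.
  move=> ij; rewrite /e -(mul_delta_mx i) tC mul_delta_mx_0 ?t0//.
  by rewrite eq_sym.
have eii i j : t (e i i) = t (e j j).
  by rewrite /e -(mul_delta_mx j) tC mul_delta_mx.
have tE Q i : t Q = \tr Q * t (e i i).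
  rewrite [Q in LHS]matrix_sum_delta tsum mulr_suml; apply: eq_bigr => k _.
  rewrite tsum (bigD1 k)//= big1 => [|j jk]; last by rewrite tZ eij ?mulr0// eq_sym.
  by rewrite addr0 tZ -(eii k).
case: n t P tL tC t1 t0 tsum tZ e eij eii tE => [|n] t P tL tC t1 t0 _ _ e _ _ tE.
  have := t1; rewrite (_ : 1%:M = 0) ?t0; last by apply/matrixP => -[].
  by move/eqP; rewrite eq_sym oner_eq0.
have := t1; rewrite (tE _ ord0) mxtrace1 => /(canRL (mulKf _)).
rewrite pnatr_eq0 => /(_ isT); rewrite mulr1 => te.
by rewrite (tE P ord0) te.
Qed.

Lemma linear_inj_mx m n (g : 'M[C]_m -> 'M[C]_n) : linear g -> injective g ->
  (m <= n)%N /\ (m = n -> forall Q, exists P, g P = Q).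
Proof.
move=> gL gI.
pose h : {linear 'M[C]_m -> 'M[C]_n} := HB.pack g (GRing.isLinear.Build _ _ _ _ g gL).
have free : row_free (lin_mx h).
  apply: inj_row_free => v; rewrite -[v]vec_mxK mul_vec_lin /= => /eqP.
  rewrite mxvec_eq0 => /eqP gv; apply/eqP; rewrite mxvec_eq0; apply/eqP/gI.
  by rewrite gv -[g]/(h : _ -> _) linear0.
split.
  have := rank_leq_col (lin_mx h); rewrite (eqP free).
  by rewrite !mulnn leq_sqr.
move=> mn Q; have full : row_full (lin_mx h) by rewrite /row_full (eqP free) mn.
have /submxP[D DE] := submx_full (mxvec Q) full.
exists (vec_mx D); apply/(can_inj mxvecK).
by rewrite DE -[D in RHS]vec_mxK mul_vec_lin.
Qed.

End TraceUnique.

Section StarMorphism.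
Context (C : numClosedFieldType) (H : hilbert C) (n : nat).
Context (f : 'M[C]_n -> H -> H) (fS : star_morphism f).
Implicit Types P Q : 'M[C]_n.

Lemma star_morphismL (a : C) P Q u : f (a *: P + Q) u = a *: f P u + f Q u.
Proof. by have [-> _ _ _] := fS. Qed.

Lemma star_morphism1 u : f 1%:M u = u.
Proof. by have [_ -> _ _] := fS. Qed.

Lemma star_morphismM P Q u : f (P *m Q) u = f P (f Q u).
Proof. by have [_ _ -> _] := fS. Qed.

Lemma star_morphism_adj P : adjoint_of (f P) (f (P^t*)).
Proof. by have [_ _ _ /(_ P)] := fS. Qed.

Lemma star_morphism0 u : f 0 u = 0.
Proof.
by have := star_morphismL (-1) 0 0 u; rewrite scaler0 addr0 scaleN1r addNr.
Qed.

Lemma star_morphismB P Q u : f (P - Q) u = f P u - f Q u.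
Proof. by rewrite addrC -scaleN1r star_morphismL scaleN1r addrC. Qed.

Lemma star_morphism_sum (J : finType) (F : J -> 'M[C]_n) u :
  f (\sum_j F j) u = \sum_j f (F j) u.
Proof.
apply: (big_morph (f^~ u) _ (star_morphism0 u)) => A B.
by rewrite -[A in LHS]scale1r star_morphismL scale1r.
Qed.

Lemma star_morphismZ (a : C) P u : f (a *: P) u = a *: f P u.
Proof. by rewrite -[a *: P]addr0 star_morphismL star_morphism0 addr0. Qed.

(** Linearity is not part of the definition of a star morphism: it follows from
    the existence of an adjoint. *)
Lemma star_morphism_linear P : linear (f P).
Proof.
move=> a u v; apply: hilbert_ext => w.
rewrite (star_morphism_adj P) linearDl /= dotZl [RHS]linearDl /= dotZl.
by rewrite !(star_morphism_adj P).
Qed.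

(** Each f (e_ij) is a contraction, because |f (e_ij) u| ^ 2 = <q u, u> with the
    projection q = f (e_jj). *)
Lemma star_morphism_bounded P : bounded_op (f P).
Proof.
split; first exact: star_morphism_linear.
have bound i j u : `|f (delta_mx i j) u| <= `|u|.
  pose q := f (delta_mx j j).
  have qE : `|f (delta_mx i j) u| ^+ 2 = dot u (q u).
    rewrite dot_norm star_morphism_adj -star_morphismM /q.
    by rewrite trmx_delta map_delta_mx mul_delta_mx.
  have qE' : `|q u| ^+ 2 = dot u (q u).
    rewrite dot_norm star_morphism_adj -star_morphismM /q.
    by rewrite trmx_delta map_delta_mx mul_delta_mx.
  have qu : `|q u| <= `|u|.
    have [->|q0] := eqVneq (q u) 0; first by rewrite normr0.
    have q0' : 0 < `|q u| by rewrite normr_gt0.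
    rewrite -(ler_pM2r q0') -expr2.
    have -> : `|q u| ^+ 2 = `|dot u (q u)| by rewrite -qE' normrX normr_id.
    exact: cauchy_schwarz.
  by rewrite -(@ler_pXn2r _ 2) ?nnegrE// qE -qE' ler_pXn2r ?nnegrE.
exists (\sum_i \sum_j `|P i j|) => u.
rewrite {1}[P]matrix_sum_delta star_morphism_sum mulr_suml.
rewrite (le_trans (ler_norm_sum _ _ _))// ler_sum// => i _.
rewrite star_morphism_sum mulr_suml (le_trans (ler_norm_sum _ _ _))// ler_sum// => j _.
by rewrite star_morphismZ normrZ ler_wpM2l.
Qed.

End StarMorphism.

(** * The matrix algebras that generate R *)
Section Tower.
Context (K : realType) (R : hyperfiniteII1 K[i]).
Local Notation C := K[i].
Local Notation M := (@Ralg C R).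
Local Notation Om := (@Omega C R).

(** A choice of the embeddings of matrix algebras provided by hyperfiniteness. *)
Record tower := Tower {
  tdim : nat -> nat;
  temb : forall k, 'M[C]_(tdim k) -> Hspace R -> Hspace R;
  temb_star : forall k, star_morphism (temb (k := k));
  temb_inj : forall k, injective (temb (k := k));
  temb_next : forall k P, exists Q, temb (k := k) P = temb (k := k.+1) Q;
  temb_gen : commutant (commutant (\bigcup_k range (temb (k := k)))) = M
}.

Lemma tower_ex : inhabited tower.
Proof.
have [N [Nle Nsub NM]] := R_hyperfinite R.
have [n [f fP]] : exists (n : nat -> nat)
    (f : forall k, 'M[C]_(n k) -> Hspace R -> Hspace R), forall k,
    [/\ star_morphism (f k), injective (f k) & N k = range (f k)].
  exists (fun k => projT1 (cid (Nsub k))).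
  exists (fun k => projT1 (cid (projT2 (cid (Nsub k))))) => k.
  exact: projT2 (cid (projT2 (cid (Nsub k)))).
have NE k : N k = range (f k) by have [] := fP k.
constructor; apply: (@Tower n f) => [k|k|k P|].
- by have [] := fP k.
- by have [] := fP k.
- have : N k.+1 (f k P) by apply: Nle; rewrite NE; exists P.
  by rewrite NE => -[Q _ QP]; exists Q.
- by under eq_bigcupr do rewrite -NE.
Qed.

Context (T : tower).
Local Notation n := (tdim T).
Local Notation f k := (@temb T k).

Lemma temb_in k P : M (f k P).
Proof.
rewrite -(temb_gen T); split; first exact: star_morphism_bounded (temb_star T k) P.
move=> y [_ yA]; apply/esym/yA; by exists k.
Qed.

Lemma temb_le k l P : (k <= l)%N -> exists Q, f k P = f l Q.
Proof.
move=> /subnK <-; elim: (l - k)%N => [|m [Q ->]]; first by exists P.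
exact: temb_next.
Qed.

Lemma temb_adj k P u : adj (f k P) u = f k (P^t*) u.
Proof.
apply: dot_inj => w; rewrite -adjE; last exact: temb_in.
exact: star_morphism_adj (temb_star T k) P _ _.
Qed.

Lemma trace_id : trace (id : Hspace R -> Hspace R) = 1.
Proof. by rewrite /trace -dot_norm Omega_unit expr1n. Qed.

Lemma trace_temb k P : trace (f k P) = ntr P.
Proof.
have fS := temb_star T k.
apply: (trace_unique (t := fun P => trace (f k P))) => [a P' Q|P' Q|].
- by rewrite /trace (star_morphismL fS) linearDl /= dotZl.
- rewrite /trace !(star_morphismM fS); apply: Omega_trace; exact: temb_in.
- by rewrite /trace (star_morphism1 fS) -dot_norm Omega_unit expr1n.
Qed.

Lemma tdim_gt0 k : (0 < n k)%N.
Proof.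
rewrite lt0n; apply/eqP => n0; have nR : (n k)%:R = 0 :> C by rewrite n0.
have := trace_temb (1%:M : 'M_(n k)); rewrite /ntr nR invr0 mulr0 /trace.
rewrite (star_morphism1 (temb_star T k)) -dot_norm Omega_unit expr1n => /eqP.
by rewrite oner_eq0.
Qed.

Lemma norm2_temb k P : norm2 (f k P) ^+ 2 = ntr (P^t* *m P).
Proof.
rewrite -trace_temb /trace (star_morphismM (temb_star T k)) /norm2 dot_norm.
by rewrite [RHS](star_morphism_adj (temb_star T k)) trmxCK.
Qed.

Definition tower_vectors : set (Hspace R) :=
  [set u | exists k P, u = f k P Om].

Lemma tower_vectors_subspace : linear_subspace tower_vectors.
Proof.
split.
  by exists 0%N, 0; rewrite (star_morphism0 (temb_star T 0)).
move=> a _ _ [k [P ->]] [l [Q ->]].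
have [P' ->] := temb_le P (leq_maxl k l).
have [Q' ->] := temb_le Q (leq_maxr k l).
by exists (maxn k l), (a *: P' + Q'); rewrite (star_morphismL (temb_star T _)).
Qed.

Lemma tower_dense x : M x -> in_closure tower_vectors (x Om).
Proof.
rewrite -(temb_gen T) => Mx; apply: (bicommutant_in_closure tower_vectors_subspace _ _ Mx).
- move=> _ [k _ [P _ <-]]; split.
    exact: star_morphism_bounded (temb_star T k) P.
  exists (f k (P^t*)); first by exists k.
  exact: star_morphism_adj (temb_star T k) P.
- move=> _ _ [k _ [P _ <-]] [l [Q ->]].
  have [P' ->] := temb_le P (leq_maxl k l).
  have [Q' ->] := temb_le Q (leq_maxr k l).
  by exists (maxn k l), (P' *m Q'); rewrite (star_morphismM (temb_star T _)).
- by exists 0%N, 1%:M; rewrite (star_morphism1 (temb_star T _)).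
Qed.

Lemma tower_approx x e : M x -> 0 < e -> exists k, forall l, (k <= l)%N ->
  exists P, norm2 (fun u => f l P u - x u) < e.
Proof.
move=> Mx e0; have [_ [k [P ->]] xP] := tower_dense Mx e0; exists k => l kl.
have [Q fQ] := temb_le P kl; exists Q.
by rewrite /norm2 -fQ distrC.
Qed.

(** The inclusion of the k-th algebra in the l-th one is an injective linear map
    between spaces of matrices, so dimensions compare. *)
Lemma tower_step k l : (k <= l)%N -> (n k <= n l)%N /\
  (n k = n l -> forall Q, exists P, f k P = f l Q).
Proof.
move=> kl; have [g gP] := choice (fun P => @temb_le k l P kl).
have gL : linear g.
  move=> a P Q; apply: (@temb_inj T l); rewrite -gP; apply/funext => u.
  by rewrite (star_morphismL (temb_star T k)) (star_morphismL (temb_star T l)) -!gP.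
have gI : injective g.
  by move=> P Q PQ; apply: (@temb_inj T k); rewrite !gP PQ.
have [le sur] := linear_inj_mx gL gI; split=> // nkl Q.
by have [P PQ] := sur nkl Q; exists P; rewrite gP PQ.
Qed.

(** If the tower stops growing at M_(n k), then R = M_(n k): the matrix A of
    x in R is its conditional expectation, for which (x - A) Omega is orthogonal
    to M_(n k) Omega. This vector is also in the closure of M_(n k) Omega, so it
    vanishes, and x = A as the trace is faithful. *)
Lemma constant_tower_finite k : (forall l, (k <= l)%N -> n l = n k) ->
  finite_dimensional M.
Proof.
move=> nk; have fS := temb_star T k.
pose b (i : 'I_(n k * n k)) := f k (vec_mx (delta_mx 0 i)).
exists (n k * n k)%N, b => x Mx.
pose A : 'M[C]_(n k) := \matrix_(i, j) ((n k)%:R * trace (f k (delta_mx j i) \o x)).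
have n0 : (n k)%:R != 0 :> C by rewrite pnatr_eq0 -lt0n tdim_gt0.
have xA : x Om - f k A Om = 0.
  apply: (in_closure_orth_eq0 (S := tower_vectors)).
    apply: in_closureB; [exact: tower_vectors_subspace|exact: tower_dense|].
    by move=> e e0; exists (f k A Om); [exists k, A|rewrite subrr normr0].
  move=> _ [l [Q ->]].
  have [P ->] : exists P, f l Q = f k P.
    have [kl|/ltnW lk] := leqP k l; last exact: temb_le.
    by have [_ /(_ (esym (nk l kl)) Q)[P PQ]] := tower_step kl; exists P.
  have dP u : dot u (f k P Om) = dot (f k (P^t*) u) Om.
    by rewrite (star_morphism_adj fS) trmxCK.
  rewrite dotBl !dP -(star_morphismM fS) -/(trace (f k _)) trace_temb.
  apply/eqP; rewrite subr_eq0; apply/eqP.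
  rewrite [P^t*]matrix_sum_delta (star_morphism_sum fS) dot_suml.
  rewrite /ntr mulmx_suml raddf_sum mulr_suml /=; apply: eq_bigr => i _.
  rewrite (star_morphism_sum fS) dot_suml mulmx_suml raddf_sum mulr_suml /=.
  apply: eq_bigr => j _.
  rewrite (star_morphismZ fS) dotZl -scalemxAl linearZ /= -mulrA; congr (_ * _).
  have -> : \tr (delta_mx i j *m A) = A j i.
    rewrite /mxtrace (bigD1 i)//= big1 => [|i' i'i].
      rewrite addr0 mxE (bigD1 j)//= big1 => [|j' j'j].
        by rewrite !mxE !eqxx mul1r addr0.
      by rewrite mxE (negbTE j'j) andbF mul0r.
    by rewrite mxE big1// => j' _; rewrite mxE (negbTE i'i) mul0r.
  by rewrite mxE mulrAC mulfV// mul1r.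
exists ((mxvec A) 0) => u.
have -> : x u = f k A u.
  have Mf := @temb_in k A; apply/eqP; rewrite -subr_eq0; apply/eqP.
  exact: (Omega_faithful (Ralg_diff Mx Mf)).
rewrite -{1}[A]mxvecK [mxvec A in LHS]row_sum_delta linear_sum.
rewrite (star_morphism_sum fS); apply: eq_bigr => i _.
by rewrite linearZ (star_morphismZ fS).
Qed.

Lemma tdim_large B : exists k, forall l, (k <= l)%N -> (B <= n l)%N.
Proof.
apply: contrapT => nB.
have nltB l : (n l < B)%N.
  rewrite ltnNge; apply/negP => Bl; apply: nB; exists l => l' ll'.
  by rewrite (leq_trans Bl)//; exact: (tower_step ll').1.
pose P m := `[< exists k, n k = m >].
have exP : exists m, P m by exists (n 0); apply/asboolP; exists 0%N.
have leP m : P m -> (m <= B)%N by move=> /asboolP[k <-]; exact/ltnW/nltB.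
have [m /asboolP[k nk] mmax] := ex_maxnP exP leP.
apply: (@R_infinite _ R); apply: (@constant_tower_finite k) => l kl.
apply/eqP; rewrite eqn_leq (tower_step kl).1 andbT nk mmax//.
by apply/asboolP; exists l.
Qed.

End Tower.

(** * Limits of complex functions along ultrafilters *)
Section Limits.

Lemma ultra_cvg_compact (T : Type) (X : topologicalType) (U : set_system T)
    (A : set X) (f : T -> X) : UltraFilter U -> compact A -> (forall t, A (f t)) ->
  exists p : X, f @ U --> p.
Proof.
move=> UU Ac fA; have fUA : (f @ U) A by apply: nearW.
have [p [_ pc]] := Ac (f @ U) _ fUA.
exists p => V Vp; have [//|nV] := in_ultra_setVsetC (f @^-1` V) UU.
by have [x [nVx Vx]] := pc (~` V) V nV Vp.
Qed.

Lemma cvg_nonneg (C : numFieldType) (T : Type) (F : set_system T)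
    {FF : ProperFilter F} (f : T -> C) (l : C) :
  (forall t, 0 <= f t) -> f @ F --> l -> 0 <= l.
Proof.
move=> f0 fl; suff : l = `|l| by move->.
apply/eqP; rewrite -subr_eq0 -normr_le0; apply/ler_addgt0Pr => e e0.
have e20 : 0 < e / 2 by rewrite divr_gt0.
have [t lt] : exists t, `|l - f t| < e / 2.
  by move/cvgrPdist_lt/(_ _ e20) : fl => /filter_ex.
rewrite add0r -(subrKA (f t)) [e](splitr e) (le_trans (ler_normD _ _))//.
rewrite lerD ?(ltW lt)// -(ger0_norm (f0 t)) distrC.
by rewrite (le_trans (ler_dist_dist _ _))// ltW.
Qed.

Lemma cvg_finsum (C : numFieldType) (T : Type) (F : set_system T) {FF : Filter F}
    (J : finType) (f : J -> T -> C) (l : J -> C) :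
  (forall j, f j @ F --> l j) -> (fun t => \sum_j f j t) @ F --> \sum_j l j.
Proof.
move=> fl; elim: (index_enum J) => [|j r IH].
  under eq_fun do rewrite big_nil.
  by rewrite big_nil; exact: cvg_cst.
under eq_fun do rewrite big_cons.
by rewrite big_cons; exact: cvgD.
Qed.

Context (K : realType).
Local Notation C := (K[i] : numClosedFieldType).

Lemma ultra_cvg_complex (T : Type) (U : set_system T) (f : T -> C) (c : C) :
  UltraFilter U -> (forall t, `|f t| <= c) -> cvg (f @ U).
Proof.
move=> UU fc; have [t0 _] := @filter_ex T U _ setT filterT.
have /complex_realP[r cr] : c \is Num.real.
  by rewrite ger0_real// (le_trans (normr_ge0 _) (fc t0)).
have bounded (g : T -> K) : (forall t, (`|g t|)%:C%C <= `|f t|) ->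
    exists p : K, g @ U --> p.
  move=> gf; apply: (ultra_cvg_compact UU (@segment_compact K (- r) r)) => t /=.
  rewrite in_itv /= -ler_norml -lecR -cr; exact: le_trans (gf t) (fc t).
have normi : `|'i%C| = 1 :> C.
  by rewrite normc_def /= expr0n expr1n/= add0r sqrtr1.
have [a fa] := bounded (fun t => complex.Re (f t)) (fun t => normc_ge_Re (f t)).
have [b fb] : exists p : K, (fun t => complex.Im (f t)) @ U --> p.
  apply: bounded => t; rewrite -[X in _ <= X]mul1r -normi -normrM.
  have -> : `|complex.Im (f t)| = `|complex.Re ('i%C * f t)|.
    by case: (f t) => x y /=; rewrite mul0r mul1r sub0r normrN.
  exact: normc_ge_Re.
apply/cvg_ex; exists (a%:C%C + 'i%C * b%:C%C); apply/cvgrPdist_lt => e e0.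
have /complex_realP[s es] := gtr0_real e0.
have s20 : 0 < s / 2 by move: e0; rewrite es (ltcR 0) => s0; rewrite divr_gt0.
move/cvgrPdist_lt/(_ _ s20) : fa => fa; move/cvgrPdist_lt/(_ _ s20) : fb => fb.
near=> t; rewrite [f t]complexE.
have -> : a%:C%C + 'i%C * b%:C%C -
    ((complex.Re (f t))%:C%C + 'i%C * (complex.Im (f t))%:C%C) =
  (a - complex.Re (f t))%:C%C + 'i%C * (b - complex.Im (f t))%:C%C.
  by rewrite !rmorphB/=; ring.
rewrite (le_lt_trans (ler_normD _ _))// normrM normi mul1r.
have normR (x : K) : `|x%:C%C| = (`|x|)%:C%C.
  by rewrite normc_def /= expr0n/= addr0 sqrtr_sqr.
rewrite !normR -rmorphD/= es ltcR [s](splitr s) ltrD//; near: t; [exact: fa|exact: fb].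
Unshelve. all: by end_near. Qed.

Lemma invn_small (e : C) : 0 < e ->
  exists N, forall n, (N <= n)%N -> n.+1%:R^-1 < e.
Proof.
move=> e0; have /complex_realP[s es] := gtr0_real e0.
have s0 : 0 < s by move: e0; rewrite es (ltcR 0).
exists (Num.bound s^-1) => n Nn.
rewrite invf_plt ?posrE// ?ltr0n// es -fmorphV/= -(rmorph_nat (real_complex K)) ltcR.
rewrite (@lt_le_trans _ _ (Num.bound s^-1)%:R) ?ler_nat ?(leqW Nn)//.
by rewrite archi_boundP// invr_ge0 ltW.
Qed.

Lemma free_near_ge (rho : free_ultrafilter) N : \forall n \near fuf rho, (N <= n)%N.
Proof.
elim: N => [|N IH]; first exact: nearW.
have : \forall n \near fuf rho, n != N.
  have nN : ~ (\bigcap_(A in fuf rho) A) N by rewrite fuf_free.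
  move: nN => /existsNP[A /not_implyP[FA AN]]; apply: filterS FA => n An.
  by apply/eqP => nN; rewrite nN in An.
by move: IH; apply: filterS2 => n; rewrite [(N < n)%N]ltn_neqAle eq_sym => -> ->.
Qed.

End Limits.

(** * The trace of the ultrapower *)
Section UltrapowerTrace.
Context (K : realType).
Local Notation C := (K[i] : numClosedFieldType).
Context (R : hyperfiniteII1 C).
Local Notation Op := (Hspace R -> Hspace R).
Local Notation Om := (@Omega C R).
Implicit Types x y : Op.

Lemma trace_le x : `|trace x| <= norm2 x.
Proof.
by rewrite (le_trans (cauchy_schwarz _ _))// Omega_unit mulr1.
Qed.

Lemma traceB x y : trace (fun u => x u - y u) = trace x - trace y.
Proof. exact: dotBl. Qed.

Context (rho : free_ultrafilter).

Lemma trace_ultra_eq (x y : bounded_seq R) (l : C) : ultra_eq rho x y ->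
  trace (x n) @[n --> fuf rho] --> l -> trace (y n) @[n --> fuf rho] --> l.
Proof.
move=> /ultra_eqP xy xl; apply/cvgrPdist_lt => e e0.
have e20 : 0 < e / 2 by rewrite divr_gt0.
move/cvgrPdist_lt/(_ _ e20) : xl; move: (xy _ e20); apply: filterS2 => n xyn xln.
rewrite -(subrKA (trace (x n))) [e](splitr e) (le_lt_trans (ler_normD _ _))//.
by rewrite ltrD// (le_lt_trans _ xyn)// -traceB trace_le.
Qed.

Lemma utrace_cvg (X : ultrapower R rho) :
  trace (repr X n) @[n --> fuf rho] --> utrace X.
Proof.
have [c c0 xc] := bounded_seq_gt0 (repr X).
apply: (@ultra_cvg_complex K nat (fuf rho) _ c) => n.
rewrite (le_trans (trace_le _))// (le_trans (xc n _))//.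
by rewrite Omega_unit mulr1.
Qed.

Lemma utrace_pi (x : bounded_seq R) :
  trace (x n) @[n --> fuf rho] --> utrace (\pi_(ultrapower R rho) x).
Proof. exact: (trace_ultra_eq (ultra_repr rho x) (@utrace_cvg _)). Qed.

Lemma utraceE (x : bounded_seq R) (l : C) : trace (x n) @[n --> fuf rho] --> l ->
  utrace (\pi_(ultrapower R rho) x) = l.
Proof.
move=> xl; have := @utrace_pi x.
by move/(cvg_unique (@norm_hausdorff _ C)); apply.
Qed.

Lemma utrace1 : utrace (@uone C R rho) = 1.
Proof.
apply: utraceE; rewrite (_ : (fun n => _) = fun=> 1); first exact: cvg_cst.
by apply/funext => n; exact: trace_id.
Qed.

Lemma utraceC (X Y : ultrapower R rho) : utrace (umul X Y) = utrace (umul Y X).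
Proof.
elim/ultrapowerW: X => x; elim/ultrapowerW: Y => y; rewrite !umul_pi.
apply: utraceE; rewrite (_ : (fun n => _) = fun n => trace (bmul y x n)).
  exact: utrace_pi.
by apply/funext => n; exact: (Omega_trace (bseq_in x n) (bseq_in y n)).
Qed.

Context (G : groupType) (theta : {multiplicative G -> unitary_group R rho}).

Lemma theta1 : theta 1%g = 1%g.
Proof. by apply: (mulgI (theta 1%g)); rewrite -gmulfM !mulg1. Qed.

Lemma thetaV g : theta (g^-1)%g = ((theta g)^-1)%g.
Proof. by apply: (mulgI (theta g)); rewrite -gmulfM !mulgV theta1. Qed.

Lemma utrace_thetaV g h : utrace (theta (g^-1 * h)%g) =
  utrace (umul (ustar (theta g)) (theta h)).
Proof. by rewrite gmulfM thetaV. Qed.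

(** Positive definiteness is the positivity of the limit of the
    |sum_i c_i x_i Omega| ^ 2, where x_i represents theta (g_i). *)
Lemma Cen_utrace_theta : Cen C G (fun g => utrace (theta g)).
Proof.
split=> [n g c|g h|].
- pose x i := repr (uval (theta (g i))).
  have uE i j : utrace (theta ((g i)^-1 * g j)%g) =
      utrace (\pi_(ultrapower R rho) (bmul (bstar (x i)) (x j))).
    by rewrite utrace_thetaV -umul_pi -ustar_pi !reprK.
  pose F i j (m : nat) : C :=
    (c i)^* * c j * trace (bmul (bstar (x i)) (x j) m).
  apply: (@cvg_nonneg C nat (fuf rho) _ (fun m => \sum_i \sum_j F i j m)) => [m|].
    have -> : \sum_i \sum_j F i j m = `|\sum_i c i *: x i m Om| ^+ 2.
      rewrite dot_norm dot_sumr; apply: eq_bigr => i _.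
      rewrite dot_suml; apply: eq_bigr => j _.
      rewrite dotZl dotZr /F mulrCA mulrA; congr (_ * _).
      by rewrite /trace /= adjEl//; exact: bseq_in.
    by rewrite exprn_ge0.
  apply: cvg_finsum => i; apply: cvg_finsum => j.
  by rewrite uE; apply: cvgM; [exact: cvg_cst|exact: utrace_pi].
- transitivity (utrace (theta (h^-1 * (g * h))%g)); first by [].
  rewrite gmulfM /= utraceC -[RHS](congr1 (fun k => utrace (theta k)) (mulgK h g)) /=.
  by rewrite [in RHS]gmulfM.
- by rewrite theta1; exact: utrace1.
Qed.

End UltrapowerTrace.

(** * From microstates to the ultrapower *)
Section Padding.
Context (C : numClosedFieldType).

(** A is repeated q times along the diagonal, followed by r ones. The size is
    a variable n related to d * q + r by a proof, so that n can be the given size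
    of a matrix algebra. *)
Definition pad d q r n (e : (d * q + r)%N = n) (A : 'M[C]_d) : 'M[C]_n :=
  castmx (e, e) (block_mx (A *t (1%:M : 'M_q)) 0 0 (1%:M : 'M_r)).

Lemma adj_pad d q r n (e : (d * q + r)%N = n) (A : 'M[C]_d) :
  (pad e A)^t* = pad e (A^t*).
Proof.
by case: n / e; rewrite /pad !castmx_id adjmx_block adjmx_tens !adjmx1.
Qed.

Lemma padM d q r n (e : (d * q + r)%N = n) (A B : 'M[C]_d) :
  pad e A *m pad e B = pad e (A *m B).
Proof.
by case: n / e; rewrite /pad !castmx_id mulmx_block_diag tensmx_mul !mulmx1.
Qed.

Lemma pad_unitary d q r n (e : (d * q + r)%N = n) (A : 'M[C]_d) :
  A \is unitarymx -> pad e A \is unitarymx.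
Proof.
move=> AU; case: n / e; rewrite /pad castmx_id.
by rewrite unitarymx_block ?unitarymx_tens ?unitarymx1.
Qed.

Lemma ntr_pad d q r n (e : (d * q + r)%N = n) (A : 'M[C]_d) :
  (0 < d)%N -> (0 < n)%N -> ntr (pad e A) = ntr A + r%:R / n%:R * (1 - ntr A).
Proof.
case: n / e => d0 n0; rewrite /pad castmx_id /ntr mxtrace_block.
rewrite mxtrace_tens !mxtrace1 natrD natrM; field.
by rewrite -natrM -natrD !pnatr_eq0 -!lt0n d0 n0.
Qed.

End Padding.

Section FromMicrostates.
Context (K : realType).
Local Notation C := (K[i] : numClosedFieldType).
Context (R : hyperfiniteII1 C) (T : tower R).
Local Notation n := (tdim T).

Definition fit k d (A : 'M[C]_d) : 'M[C]_(n k) :=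
  pad (etrans (congr1 (addn^~ (n k %% d)%N) (mulnC d (n k %/ d)%N))
    (esym (divn_eq (n k) d))) A.

Lemma ntr_fit_cvg d (A : 'M[C]_d) : (0 < d)%N ->
  ntr (fit k A) @[k --> \oo] --> ntr A.
Proof.
move=> d0; apply/cvgrPdist_lt => e e0.
pose c := `|1 - ntr A| * d%:R + 1.
have c0 : 0 < c by rewrite ltr_wpDl// mulr_ge0.
have [N Ne] := invn_small (divr_gt0 e0 c0).
have [k0 k0P] := tdim_large T N.+1.
exists k0 => // k /= k0k; rewrite /fit ntr_pad ?tdim_gt0//.
rewrite opprD addrA subrr sub0r normrN normrM.
have nk := k0P k k0k.
have nkV : (n k)%:R^-1 < e / c.
  by have := Ne (n k).-1; rewrite prednK ?tdim_gt0//; apply; rewrite -ltnS prednK ?tdim_gt0.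
rewrite (@le_lt_trans _ _ ((n k)%:R^-1 * c))//; last by rewrite -ltr_pdivlMr.
rewrite ger0_norm ?divr_ge0// mulrAC mulrC ler_wpM2l ?invr_ge0//.
rewrite (@le_trans _ _ (`|1 - ntr A| * d%:R)) ?lerDl//.
by rewrite mulrC ler_wpM2l// ler_nat ltnW// ltn_mod.
Qed.

Lemma norm2_unitary_dist k (U V : 'M[C]_(n k)) :
  U \is unitarymx -> V \is unitarymx -> let z := ntr (U^t* *m V) in
  norm2 (fun u => temb U u - temb V u) ^+ 2 = 2 - (z + z^*).
Proof.
move=> UU VU z; rewrite /norm2 hilbert_normB.
have n2 (W : 'M[C]_(n k)) : W \is unitarymx -> `|temb W (Omega R)| ^+ 2 = 1.
  move=> WU; rewrite -/(norm2 (temb W)) norm2_temb unitarymxPC// ntr1//.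
  exact: tdim_gt0.
rewrite !n2// /z -trace_temb /trace (star_morphismM (temb_star T k)).
rewrite [dot (temb (U^t*) _) _](star_morphism_adj (temb_star T k)) trmxCK.
rewrite (dotC (temb U _)) conjCK.
by rewrite [X in _ - X]addrC.
Qed.

End FromMicrostates.

Section HypFromMicrostates.
Context (K : realType).
Local Notation C := (K[i] : numClosedFieldType).
Context (R : hyperfiniteII1 C) (T : tower R).
Context (G : groupType) (phi : G -> C) (M : microstates phi).
Local Notation n := (tdim T).
Local Existing Instance ms_proper.

Let J : countType := {i : ms_index M & nat}.
Let F : set_system J := iterated (ms_filter M) (fun=> \oo : set_system nat).

#[local] Instance fitted_filter_proper : ProperFilter F.
Proof. exact: iterated_filter. Qed.

Let fitted (j : J) g : 'M[C]_(n (tagged j)) := fit T (tagged j) (ms_mx (tag j) g).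

Lemma fitted_unitary j g : fitted j g \is unitarymx.
Proof. by apply: pad_unitary; exact: ms_unitary. Qed.

Lemma ntr_fitted g : ntr (fitted j g) @[j --> F] --> phi g.
Proof.
apply: (@cvg_iterated _ _ _ _ _ _ _ _ (fun i => ntr (ms_mx i g))); last exact: ms_tr.
by move=> i; apply: ntr_fit_cvg; exact: ms_dim_gt0.
Qed.

Lemma ntr_fitted_mul g h :
  ntr ((fitted j (g * h)%g)^t* *m (fitted j g *m fitted j h)) @[j --> F] -->
    (1 : C).
Proof.
apply: (@cvg_iterated _ _ _ _ _ _ _ _
  (fun i => ntr ((ms_mx i (g * h)%g)^t* *m (ms_mx i g *m ms_mx i h))));
  last exact: ms_mul.
move=> i; rewrite /fitted /fit; under eq_fun do rewrite adj_pad !padM.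
by apply: ntr_fit_cvg; exact: ms_dim_gt0.
Qed.

(** An ultrafilter refining F is free because k tends to infinity: for fixed i,
    a natural number is the code of at most one pair (i, k). *)
Lemma exists_free_ultrafilter : exists rho : free_ultrafilter,
  @pickle J @ F `<=` fuf rho.
Proof.
have [U [UU FU]] := ultraFilterLemma (_ : ProperFilter (@pickle J @ F)).
have Ufree : \bigcap_(A in U) A = set0.
  apply/seteqP; split=> // m /= mU.
  suff : U [set m' | m' <> m] by move=> /mU.
  apply: FU; apply: nearW => i /=.
  have [[k0 mk0]|nk] := pselect (exists k, pickle (existT _ i k : J) = m).
    exists k0.+1 => // k /= kk0 km; move: (kk0).
    have /(pcan_inj (@pickleK J)) : pickle (existT _ i k : J) = pickle (existT _ i k0 : J).
      by rewrite km mk0.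
    by move/(congr1 (fun j : J => tagged j)) => /= ->; rewrite ltnn.
  by apply: nearW => k km; apply: nk; exists k.
by exists (FreeUltrafilter UU Ufree).
Qed.

(** Pairs of indices are numbered by [pickle], which need not be onto; the
    identity fills the gaps, as the sequence has to consist of unitaries. *)
Definition fitted_op g m : Hspace R -> Hspace R :=
  if unpickle m is Some j then temb (fitted j g) else id.

Lemma fitted_op_in g m : Ralg (fitted_op g m).
Proof.
by rewrite /fitted_op; case: unpickle => [j|]; [exact: temb_in|exact: Ralg_id].
Qed.

Lemma fitted_op_isometry g m u : adj (fitted_op g m) (fitted_op g m u) = u.
Proof.
rewrite /fitted_op; case: unpickle => [j|]; last exact: adj_id.
rewrite temb_adj -(star_morphismM (temb_star T _)) unitarymxPC ?fitted_unitary//.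
exact: star_morphism1 (temb_star T _) _.
Qed.

Lemma fitted_op_coisometry g m u : fitted_op g m (adj (fitted_op g m) u) = u.
Proof.
rewrite /fitted_op; case: unpickle => [j|]; last exact: adj_id.
rewrite temb_adj -(star_morphismM (temb_star T _)).
rewrite (unitarymxP (fitted_unitary _ _)).
exact: star_morphism1 (temb_star T _) _.
Qed.

Lemma fitted_op_bounded g :
  exists c : C, forall m u, `|fitted_op g m u| <= c * `|u|.
Proof.
exists 1 => m u; rewrite mul1r -(@ler_pXn2r _ 2) ?nnegrE// !dot_norm.
by rewrite adjE ?fitted_op_isometry//; exact: fitted_op_in.
Qed.

Definition fitted_seq g := BoundedSeq (fitted_op_in g) (fitted_op_bounded g).

Lemma fitted_seqE g j : fitted_seq g (pickle j) = temb (fitted j g).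
Proof. by rewrite /= /fitted_op pickleK. Qed.

Section Representation.
Context (rho : free_ultrafilter) (Frho : @pickle J @ F `<=` fuf rho).

Lemma trace_fitted_seq g : trace (fitted_seq g m) @[m --> fuf rho] --> phi g.
Proof.
apply: (@cvg_trans _ ((fun m => trace (fitted_seq g m)) @ (@pickle J @ F))).
  by move=> A /= FA; apply: Frho.
suff : (fun j => trace (fitted_seq g (pickle j))) @ F --> phi g by [].
under eq_fun do rewrite fitted_seqE trace_temb.
exact: ntr_fitted.
Qed.

Lemma fitted_seq_mul g h :
  ultra_eq rho (fitted_seq (g * h)%g) (bmul (fitted_seq g) (fitted_seq h)).
Proof.
apply/ultra_eqP => e e0; apply: Frho => /=.
have e20 : 0 < e ^+ 2 / 2 by rewrite divr_gt0// exprn_gt0.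
have := ntr_fitted_mul g h; move/cvgrPdist_lt/(_ _ e20); apply: (@filterS _ F) => j.
set z := ntr _ => ze.
rewrite /= -(@ltr_pXn2r _ 2) ?nnegrE ?(ltW e0) ?normr_ge0// /fitted_op !pickleK.
have -> : norm2 (fun u => temb (fitted j (g * h)%g) u
      - (temb (fitted j g) \o temb (fitted j h)) u)
    = norm2 (fun u => temb (fitted j (g * h)%g) u - temb (fitted j g *m fitted j h) u).
  by rewrite /norm2 (star_morphismM (temb_star T _)).
have : 0 <= norm2 (fun u => temb (fitted j (g * h)%g) u
    - temb (fitted j g *m fitted j h) u) ^+ 2 by rewrite exprn_ge0 ?normr_ge0.
rewrite norm2_unitary_dist ?mul_unitarymx ?fitted_unitary// -/z.
have -> : 2 - (z + z^*) = (1 - z) + (1 - z)^* by rewrite rmorphB rmorph1; ring.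
move=> r0.
rewrite -(ger0_norm r0) (le_lt_trans (ler_normD _ _))// norm_conjC.
by rewrite [e ^+ 2](splitr (e ^+ 2)) ltrD.
Qed.

Let fitted_class g : ultrapower R rho := \pi_(ultrapower R rho) (fitted_seq g).

Lemma fitted_class_unitary g : unitary (fitted_class g).
Proof.
rewrite /unitary /fitted_class ustar_pi !umul_pi; apply/andP; split; apply/eqP/pi_eq.
  by apply: ultra_eq_ext => m u; exact: fitted_op_isometry.
by apply: ultra_eq_ext => m u; exact: fitted_op_coisometry.
Qed.

Definition fitted_rep g : unitary_group R rho := Unitary (fitted_class_unitary g).

Lemma fitted_repM : {morph fitted_rep : g h / (g * h)%g}.
Proof.
by move=> g h; apply: val_inj; rewrite /= umul_pi; apply/pi_eq; exact: fitted_seq_mul.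
Qed.

Lemma Hyp_of_ultrafilter : Hyp G R phi.
Proof.
pose theta : {multiplicative G -> unitary_group R rho} :=
  HB.pack fitted_rep (isMultiplicative.Build _ _ fitted_rep fitted_repM).
have thetaE g : utrace (theta g) = phi g by apply: utraceE; exact: trace_fitted_seq.
split; last by exists rho, theta.
have -> : phi = (fun g => utrace (theta g)) by apply/funext => g; rewrite thetaE.
exact: Cen_utrace_theta.
Qed.

End Representation.

Lemma Hyp_of_microstates : Hyp G R phi.
Proof. by have [rho Frho] := exists_free_ultrafilter; exact: Hyp_of_ultrafilter Frho. Qed.

End HypFromMicrostates.

(** * Approximating unitaries of the ultrapower by unitary matrices *)

(** The characteristic polynomial has finitely many roots, and e / 2, e / 3, ...
    are infinitely many candidates. *)
Lemma shift_unitmx (C : numClosedFieldType) m (P : 'M[C]_m) (e : C) : 0 < e ->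
  exists2 t : C, 0 < t < e & P + t%:M \in unitmx.
Proof.
move=> e0; pose t (j : nat) := e / j.+2%:R.
have t_inj : injective t.
  by move=> j l /(mulfI (lt0r_neq0 e0))/invr_inj/eqP; rewrite eqr_nat => /eqP[].
have t_lt j : 0 < t j < e.
  by rewrite divr_gt0//= ltr_pdivrMr// ltr_pMr// ltr1n.
apply: contrapT => none.
have tr j : root (char_poly (- P)) (t j).
  apply/negPn/negP => nr; apply: none; exists (t j) => //.
  rewrite -eigenvalue_root_char in nr.
  move: nr; rewrite /eigenvalue /eigenspace negbK kermx_eq0 row_free_unit.
  by rewrite -opprD -scaleN1r unitmxZ// unitrN1.
pose rs := [seq t j | j <- iota 0 m.+1].
have rs_root : all (root (char_poly (- P))) rs by apply/allP => _ /mapP[j _ ->].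
have rs_uniq : uniq rs by rewrite map_inj_uniq ?iota_uniq.
have := max_poly_roots (monic_neq0 (char_poly_monic (- P))) rs_root rs_uniq.
by rewrite size_char_poly size_map size_iota ltnn.
Qed.

Section Approximation.
Context (K : realType).
Local Notation C := (K[i] : numClosedFieldType).
Context (R : hyperfiniteII1 C) (T : tower R).
Local Notation n := (tdim T).
Local Notation M := (@Ralg C R).
Local Notation Op := (Hspace R -> Hspace R).
Local Notation Om := (@Omega C R).
Implicit Types x y : Op.

Lemma norm2_ge0 x : 0 <= norm2 x. Proof. exact: normr_ge0. Qed.

Lemma norm2_temb_unitary k (U : 'M[C]_(n k)) x : M x -> U \is unitarymx ->
  norm2 (x \o temb U) <= norm2 x.
Proof.
move=> Mx UU; rewrite -[leRHS]mul1r; apply: norm2_comp => //; first exact: temb_in.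
move=> u; rewrite mul1r -(@ler_pXn2r _ 2) ?nnegrE// !dot_norm.
rewrite (star_morphism_adj (temb_star T k)) -(star_morphismM (temb_star T k)).
by rewrite unitarymxPC// (star_morphism1 (temb_star T k)).
Qed.

Lemma norm2_temb_unitary1 k (U : 'M[C]_(n k)) : U \is unitarymx -> norm2 (temb U) = 1.
Proof.
move=> UU; apply/eqP; rewrite -(@eqrXn2 _ 2) ?norm2_ge0//.
by rewrite norm2_temb unitarymxPC// ntr1 ?tdim_gt0// expr1n.
Qed.

Lemma cauchy_schwarz_trace x y : M x -> `|trace (adj x \o y)| <= norm2 x * norm2 y.
Proof. by move=> Mx; rewrite /trace /= adjEl// mulrC cauchy_schwarz. Qed.

(** With y = A - x, and S the unitary of [polar_approx],
    tr ((A^* A - 1) S) = tr (A^* y S) + tr (y^* x S) + tr ((x^* x - 1) S);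
    the Cauchy-Schwarz inequality bounds each term by 2-norms. *)
Lemma polar_estimate k (A : 'M[C]_(n k)) x e :
  M x -> A \in unitmx -> norm2 (fun u => temb A u - x u) <= e ->
  exists2 W : 'M[C]_(n k), W \is unitarymx &
    norm2 (fun u => temb A u - temb W u) ^+ 2 <=
      e * (2 * norm2 x + e) + norm2 (fun u => (adj x \o x) u - u).
Proof.
move=> Mx Au Ax; have fS := temb_star T k.
have [W [S [WU SU AWS]]] := polar_approx Au; exists W => //.
have -> : norm2 (fun u => temb A u - temb W u) = norm2 (temb (A - W)).
  by rewrite /norm2 (star_morphismB fS).
rewrite norm2_temb; set lhs := ntr _ in AWS *.
have lhs0 : 0 <= lhs by rewrite /lhs -norm2_temb exprn_ge0// norm2_ge0.
apply: (le_trans AWS); rewrite -(ger0_norm (le_trans lhs0 AWS)) -trace_temb.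
have MA := temb_in A; have MS := temb_in S.
pose y : Op := fun u => temb A u - x u.
have My : M y by exact: Ralg_diff.
have Ma := Ralg_adj Mx.
pose z : Op := fun u => (adj x \o x) u - u.
have Mz : M z by apply: Ralg_diff; [exact: Ralg_comp|exact: Ralg_id].
have -> : trace (temb ((A^t* *m A - 1%:M) *m S)) =
    trace (adj (temb A) \o (y \o temb S)) + trace (adj y \o (x \o temb S))
    + trace (adj (adj z) \o temb S).
  rewrite /trace -!dotDl; congr (dot _ Om) => /=.
  rewrite (star_morphismM fS) (star_morphismB fS) (star_morphism1 fS).
  rewrite (star_morphismM fS) -temb_adj; set v := temb S Om.
  rewrite adjK// /z /= (adj_diff _ MA Mx) /y (Ralg_sub _ _ (Ralg_adj MA)).
  by rewrite !addrA !subrK.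
rewrite (le_trans (ler_normD _ _))// lerD//; last first.
  rewrite (le_trans (cauchy_schwarz_trace _ (Ralg_adj Mz)))// norm2_temb_unitary1// mulr1.
  by rewrite norm2_adj.
have nA : norm2 (temb A) <= norm2 x + e.
  rewrite /norm2 -[temb A Om](subrK (x Om)) addrC (le_trans (ler_normD _ _))//.
  by rewrite lerD2l.
rewrite (le_trans (ler_normD _ _))//.
have -> : e * (2 * norm2 x + e) = (norm2 x + e) * e + e * norm2 x by ring.
have e0 : 0 <= e by exact: le_trans (norm2_ge0 _) Ax.
rewrite lerD//.
  rewrite (le_trans (cauchy_schwarz_trace _ MA))// ler_pM ?norm2_ge0//.
  by rewrite (le_trans (norm2_temb_unitary _ SU))//.
rewrite (le_trans (cauchy_schwarz_trace _ My))// ler_pM ?norm2_ge0//.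
exact: norm2_temb_unitary.
Qed.

(** Choose A invertible with |A - x|_2 < e, where e is so small that
    the bound of [polar_estimate] is at most h ^ 2. *)
Lemma unitary_approx x (h : C) : M x -> 0 < h ->
  norm2 (fun u => (adj x \o x) u - u) < h ^+ 2 ->
  exists k0, forall k, (k0 <= k)%N -> exists2 W : 'M[C]_(n k), W \is unitarymx &
    norm2 (fun u => temb W u - x u) < 2 * h.
Proof.
move=> Mx h0; set d := norm2 _ => dh; set s := norm2 x.
have kap0 : 0 < h ^+ 2 - d by rewrite subr_gt0.
set kap := h ^+ 2 - d in kap0.
have s0 : 0 <= s by exact: norm2_ge0.
pose q := h * (2 * s + h); have q0 : 0 < q by rewrite mulr_gt0// ltr_wpDl ?mulr_ge0.
(* This e is at most h, and at most kap / (2 s + h). *)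
pose e := kap * h / (kap + q).
have kq0 : 0 < kap + q by rewrite addr_gt0.
have e0 : 0 < e by rewrite divr_gt0 ?mulr_gt0.
have eh : e <= h.
  by rewrite ler_pdivrMr// mulrC ler_pM2l// lerDl ltW.
have ekap : e * (2 * s + e) <= kap.
  rewrite (@le_trans _ _ (e * (2 * s + h)))//.
    by rewrite ler_pM2l// lerD2l.
  have -> : e * (2 * s + h) = kap * (q / (kap + q)) by rewrite /e /q; ring.
  by rewrite ger_pMr// ler_pdivrMr// mul1r lerDr ltW.
have e20 : 0 < e / 2 by rewrite divr_gt0.
have [k0 k0P] := tower_approx T Mx e20; exists k0 => k /k0P[P Px].
have [t /andP[t0 te] tu] := shift_unitmx P e20.
have Ax : norm2 (fun u => temb (P + t%:M) u - x u) < e.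
  rewrite [e](splitr e) (le_lt_trans _ (ltrD Px te))//.
  have -> : P + t%:M = t *: 1%:M + P by rewrite scalemx1 addrC.
  rewrite /norm2 (star_morphismL (temb_star T k)).
  rewrite (star_morphism1 (temb_star T k)) -addrA addrC.
  by rewrite (le_trans (ler_normD _ _))// normrZ Omega_unit mulr1 ger0_norm// ltW.
have [W WU WA] := polar_estimate Mx tu (ltW Ax); exists W => //.
have {}WA : norm2 (fun u => temb (P + t%:M) u - temb W u) <= h.
  rewrite -(@ler_pXn2r _ 2) ?nnegrE ?norm2_ge0 ?(ltW h0)// (le_trans WA)//.
  by rewrite -/s -/d -lerBrDr.
have -> : 2 * h = h + h by ring.
rewrite (le_lt_trans _ (ler_ltD WA (lt_le_trans Ax eh)))//.
rewrite /norm2 -(subrKA (temb (P + t%:M) Om)) (le_trans (ler_normD _ _))//.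
by rewrite distrC.
Qed.

End Approximation.

Section MicrostatesOfHyp.
Context (K : realType).
Local Notation C := (K[i] : numClosedFieldType).
Context (R : hyperfiniteII1 C) (T : tower R).
Context (G : groupType) (rho : free_ultrafilter).
Context (theta : {multiplicative G -> unitary_group R rho}).
Local Notation n := (tdim T).
Local Notation Om := (@Omega C R).

Lemma pi_ultra_eq (x y : bounded_seq R) :
  \pi_(ultrapower R rho) x = \pi_(ultrapower R rho) y -> ultra_eq rho x y.
Proof. by move=> /eqquotP. Qed.

Definition theta_lift g : bounded_seq R := repr (uval (theta g)).

Definition unitary_defect g m : C :=
  norm2 (fun u => (adj (theta_lift g m) \o theta_lift g m) u - u).

Lemma near_unitary_defect g (e : C) : 0 < e ->
  \forall m \near fuf rho, unitary_defect g m < e.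
Proof.
move=> e0; have : ultra_eq rho (bmul (bstar (theta_lift g)) (theta_lift g)) (bone R).
  apply: pi_ultra_eq; rewrite -umul_pi -ustar_pi reprK; exact: unitaryVl.
by move/ultra_eqP/(_ e e0).
Qed.

Lemma theta_lift_mul g h :
  ultra_eq rho (theta_lift (g * h)%g) (bmul (theta_lift g) (theta_lift h)).
Proof. by apply: pi_ultra_eq; rewrite -umul_pi !reprK gmulfM. Qed.

(** The term 1 / (m + 1) makes the tolerance positive when the defect is 0, so
    that its square is always larger than the defect. It tends to 0 along rho
    because rho is free. *)
Definition tolerance g m : C := sqrtC (unitary_defect g m) + m.+1%:R^-1.

Lemma tolerance_gt0 g m : 0 < tolerance g m.
Proof. by rewrite ltr_wpDl ?invr_gt0 ?ltr0Sn// sqrtC_ge0 normr_ge0. Qed.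

Lemma near_tolerance g (e : C) : 0 < e -> \forall m \near fuf rho, tolerance g m < e.
Proof.
move=> e0; have e20 : 0 < e / 2 by rewrite divr_gt0.
have [N Ne] := invn_small e20.
have := near_unitary_defect g (exprn_gt0 2 e20); have := free_near_ge rho N.
apply: filterS2 => m /Ne mV md; rewrite /tolerance [e](splitr e) ltrD//.
rewrite -(@ltr_pXn2r _ 2) ?nnegrE ?sqrtC_ge0 ?(ltW e20) ?normr_ge0//.
by rewrite sqrtCK.
Qed.

Lemma near_lift_unitary g m : exists k0, forall k, (k0 <= k)%N ->
  exists2 W : 'M[C]_(n k), W \is unitarymx &
    norm2 (fun u => temb W u - theta_lift g m u) < 2 * tolerance g m.
Proof.
apply: unitary_approx => //; [exact: bseq_in|exact: tolerance_gt0|].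
have d0 : 0 <= unitary_defect g m by exact: normr_ge0.
rewrite -[X in X < _]/(unitary_defect g m) -{1}[unitary_defect g m]sqrtCK.
have m0 : 0 < m.+1%:R^-1 :> C by rewrite invr_gt0.
by rewrite ltr_pXn2r ?nnegrE ?sqrtC_ge0 ?ltrDl ?(ltW (tolerance_gt0 _ _)).
Qed.

(** The matrices are chosen for all (m, k) at once, and the size n k does not
    depend on g: only how large k has to be depends on g and m. This is what the
    iterated filter accommodates, whatever the cardinality of G. *)
Lemma lift_unitary_ex :
  exists W : forall j : {_ : nat & nat}, G -> 'M[C]_(n (tagged j)),
  (forall j g, W j g \is unitarymx) /\
  forall g m, \forall k \near \oo,
    norm2 (fun u => temb (W (existT _ m k) g) u - theta_lift g m u) < 2 * tolerance g m.
Proof.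
pose good (j : {_ : nat & nat}) g (W : 'M[C]_(n (tagged j))) :=
  norm2 (fun u => temb W u - theta_lift g (tag j) u) < 2 * tolerance g (tag j).
have ex j g : exists W : 'M[C]_(n (tagged j)), W \is unitarymx /\
    ((exists2 W, W \is unitarymx & good j g W) -> good j g W).
  have [[W WU Wg]|none] := pselect (exists2 W, W \is unitarymx & good j g W).
    by exists W.
  by exists 1%:M; split=> //; exact: unitarymx1.
exists (fun j g => projT1 (cid (ex j g))); split=> [j g|g m].
  by have [] := projT2 (cid (ex j g)).
have [k0 k0P] := near_lift_unitary g m; exists k0 => // k /= /k0P kW.
by have [_] := projT2 (cid (ex (existT _ m k) g)); apply.
Qed.

Lemma unitary_overlap k (U V : 'M[C]_(n k)) : U \is unitarymx ->
  `|1 - ntr (U^t* *m V)| <= norm2 (fun u => temb U u - temb V u).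
Proof.
move=> UU; have fS := temb_star T k.
have -> : 1 - ntr (U^t* *m V) = ntr (U^t* *m (U - V)).
  rewrite mulmxBr unitarymxPC// /ntr linearB /= mulrBl; congr (_ - _).
  by rewrite -/(ntr _) ntr1 ?tdim_gt0.
have -> : (fun u => temb U u - temb V u) = temb (U - V).
  by apply/funext => u; rewrite (star_morphismB fS).
rewrite -trace_temb; have := cauchy_schwarz_trace (temb (U - V)) (temb_in U).
rewrite norm2_temb_unitary1// mul1r; congr (_ <= _); congr (`|_|).
by rewrite /trace /= temb_adj (star_morphismM fS).
Qed.

Lemma microstates_of_theta : inhabited (microstates (fun g => utrace (theta g))).
Proof.
have [W [WU Wlift]] := lift_unitary_ex.
pose J : countType := {_ : nat & nat}.
pose F : set_system J := iterated (fuf rho) (fun=> \oo : set_system nat).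
have FF : ProperFilter F by exact: iterated_filter.
have Wtr g : ntr (W j g) @[j --> F] --> utrace (theta g).
  apply/cvgrPdist_lt => e e0.
  have e20 : 0 < e / 2 by rewrite divr_gt0.
  have e40 : 0 < e / 2 / 2 by rewrite divr_gt0.
  have /cvgrPdist_lt/(_ _ e20) := @utrace_cvg K R rho (theta g).
  have := near_tolerance g e40; apply: filterS2 => m mtol mtr.
  move: (Wlift g m); apply: filterS => k Wk.
  rewrite -(subrKA (trace (theta_lift g m))) [e](splitr e).
  rewrite (le_lt_trans (ler_normD _ _))// ltrD//.
  rewrite -trace_temb -traceB (le_lt_trans (trace_le _))// /norm2 distrC.
  by rewrite (lt_trans Wk)// mulrC -ltr_pdivlMr.
have Wmul g h : ntr ((W j (g * h)%g)^t* *m (W j g *m W j h)) @[j --> F] --> (1 : C).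
  apply/cvgrPdist_lt => e e0.
  have [c c0 gc] := bounded_seq_gt0 (theta_lift g).
  have e40 : 0 < e / 2 / 2 by rewrite !divr_gt0.
  have e80 : 0 < e / 2 / 2 / 2 by rewrite !divr_gt0.
  have ec0 : 0 < e / 2 / 2 / 2 / c by rewrite divr_gt0.
  have /ultra_eqP/(_ _ e40) near_mul := theta_lift_mul g h.
  have near4 : \forall m \near fuf rho, [/\ tolerance g m < e / 2 / 2 / 2,
      tolerance h m < e / 2 / 2 / 2 / c, tolerance (g * h)%g m < e / 2 / 2 / 2 &
      norm2 (fun u => theta_lift (g * h)%g m u
        - (theta_lift g m \o theta_lift h m) u) < e / 2 / 2].
    near=> m; split; near: m; [exact: near_tolerance..|exact: near_mul].
  pose P (j : J) : Prop := `|1 - ntr ((W j (g * h)%g)^t* *m (W j g *m W j h))| < e.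
  suff : \forall m \near fuf rho, \forall k \near \oo, P (existT _ m k) by [].
  move: near4; apply: filterS => m [tg th tgh mm].
  have near3 : \forall k \near \oo, [/\
      norm2 (fun u => temb (W (existT _ m k) g) u - theta_lift g m u) < 2 * tolerance g m,
      norm2 (fun u => temb (W (existT _ m k) h) u - theta_lift h m u) < 2 * tolerance h m &
      norm2 (fun u => temb (W (existT _ m k) (g * h)%g) u - theta_lift (g * h)%g m u)
        < 2 * tolerance (g * h)%g m].
    near=> k; split; near: k; exact: Wlift.
  move: near3; apply: filterS => k [Wg Wh Wgh].
  set j := existT _ m k; rewrite /P.
  apply: le_lt_trans (unitary_overlap _ (WU j _)) _.
  have MWg := temb_in (W j g); have Mg := bseq_in (theta_lift g) m.
  have Wg' : norm2 (fun u => theta_lift g m (temb (W j h) u)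
      - temb (W j g) (temb (W j h) u)) < e / 2 / 2.
    apply: (le_lt_trans (norm2_temb_unitary (Ralg_diff Mg MWg) (WU j h))).
    by rewrite /norm2 distrC (lt_trans Wg)// mulrC -ltr_pdivlMr.
  have Wh' : norm2 (fun u => theta_lift g m (theta_lift h m u) - theta_lift g m (temb (W j h) u))
      < e / 2 / 2.
    rewrite /norm2 -(Ralg_sub _ _ Mg) (le_lt_trans (gc m _))// mulrC -ltr_pdivlMr//.
    by rewrite distrC (lt_trans Wh)// mulrC -ltr_pdivlMr// mulrAC.
  have {}Wgh : norm2 (fun u => temb (W j (g * h)%g) u - theta_lift (g * h)%g m u) < e / 2 / 2.
    by rewrite (lt_trans Wgh)// mulrC -ltr_pdivlMr.
  rewrite [e](splitr e) {1 2}[e / 2](splitr (e / 2)) /norm2.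
  rewrite (star_morphismM (temb_star T _)).
  rewrite -(subrKA (theta_lift g m (theta_lift h m Om))) (le_lt_trans (ler_normD _ _))//.
  apply: le_lt_trans (ltrD (ltrD Wgh mm) (ltrD Wh' Wg')).
  by rewrite lerD// ler_distD.
constructor; exact: (@Microstates _ _ _ J F FF _
  (fun j : J => tdim_gt0 T (tagged j)) W WU Wtr Wmul).
Unshelve. all: by end_near. Qed.

End MicrostatesOfHyp.

(** * Closure properties and annihilators of Hyp(G) *)
Section Closure.
Context (K : realType).
Local Notation C := (K[i] : numClosedFieldType).
Context (R : hyperfiniteII1 C) (G : groupType).
Implicit Types phi psi : G -> C.

Lemma HypP phi : Hyp G R phi <-> inhabited (microstates phi).
Proof.
have [T] := tower_ex R; split=> [[_ [rho [theta thetaE]]]|[M]].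
  have -> : phi = (fun g => utrace (theta g)) by apply/funext => g; rewrite thetaE.
  exact: microstates_of_theta.
exact: Hyp_of_microstates M.
Qed.

Lemma Hyp_punit : Hyp G R (punit C (G := G)).
Proof. by apply/HypP; constructor; exact: microstates_punit. Qed.

Lemma Hyp_pmul phi psi : Hyp G R phi -> Hyp G R psi -> Hyp G R (pmul phi psi).
Proof.
by move=> /HypP[M] /HypP[N]; apply/HypP; constructor; exact: microstates_pmul.
Qed.

Lemma Hyp_lim (omega : set_system nat) (phi : nat -> G -> C) psi :
  ProperFilter omega -> (forall m, Hyp G R (phi m)) ->
  (forall g, phi m g @[m --> omega] --> psi g) -> Hyp G R psi.
Proof.
move=> FF /(_ _)/HypP phiH phipsi; apply/HypP; constructor.
apply: (microstates_lim (omega := omega) _ phipsi) => m.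
by have /cid[M _] : exists M : microstates (phi m), True by have [M] := phiH m; exists M.
Qed.

(** The multiplicities are a m = floor (t (m + 1)) and b m = m + 1 - a m. *)
Lemma rational_approx (t : C) : 0 <= t <= 1 ->
  exists a b : nat -> nat, (forall m, 0 < a m + b m)%N /\
    (a m)%:R / (a m + b m)%:R @[m --> \oo] --> t.
Proof.
move=> /andP[t0 t1]; have /complex_realP[r tr] := ger0_real t0.
have r0 : 0 <= r by rewrite -ler0c -tr.
have r1 : r <= 1 by rewrite -lecR -tr.
pose a m := Num.truncn (r * m.+1%:R).
have aP m : (a m)%:R <= r * m.+1%:R < (a m).+1%:R.
  by apply: truncn_itv; rewrite mulr_ge0.
have am m : (a m <= m.+1)%N.
  have /andP[le _] := aP m; rewrite -(ler_nat K) (le_trans le)//.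
  by rewrite ler_piMl.
exists a, (fun m => m.+1 - a m)%N; split=> [m|]; first by rewrite subnKC.
apply/cvgrPdist_lt => e e0; have [N Ne] := invn_small e0.
exists N => // m /= Nm; rewrite subnKC//.
have m0 : 0 < m.+1%:R :> K by rewrite ltr0n.
have -> : t - (a m)%:R / m.+1%:R = (r - (a m)%:R / m.+1%:R)%:C%C.
  by rewrite tr rmorphB/= fmorph_div /= !rmorph_nat.
have /andP[le lt] := aP m.
have d0 : 0 <= r - (a m)%:R / m.+1%:R by rewrite subr_ge0 ler_pdivrMr.
rewrite ger0_norm ?ler0c// (le_lt_trans _ (Ne m Nm))//.
rewrite -(rmorph_nat (real_complex K)) -fmorphV/= lecR lerBlDr.
rewrite (_ : _ + _ = ((a m)%:R + 1) / m.+1%:R); last by rewrite mulrDl mul1r addrC.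
rewrite ler_pdivlMr// natr1.
exact: ltW.
Qed.

Lemma Hyp_convex (t : C) phi psi : 0 <= t <= 1 ->
  Hyp G R phi -> Hyp G R psi -> Hyp G R (fun g => t * phi g + (1 - t) * psi g).
Proof.
move=> /rational_approx[a [b [ab0 abt]]] /HypP[M] /HypP[N].
by apply/HypP; constructor; exact: microstates_convex ab0 abt M N.
Qed.

(** Split off the first term and normalize the remaining weights, unless they
    all vanish. *)
Lemma convex_combinations (X : set (G -> C)) :
  (forall (t : C) phi psi, 0 <= t <= 1 -> X phi -> X psi ->
    X (fun g => t * phi g + (1 - t) * psi g)) ->
  closed_under_convex_combinations X.
Proof.
move=> Xconv; elim=> [|m IH] t phi t0.
  by rewrite big_ord0 => /eqP; rewrite eq_sym oner_eq0.
rewrite big_ord_recl => t1 Xphi.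
pose s := \sum_(i < m) t (lift ord0 i).
have sE : s = 1 - t ord0 by rewrite -t1 addrC addKr.
have s0 : 0 <= s by rewrite sumr_ge0.
have [s00|s_neq0] := eqVneq s 0.
  have ti i : t (lift ord0 i) = 0.
    by apply: (psumr_eq0P _ s00) => // j _; exact: t0.
  have t01 : t ord0 = 1 by apply/eqP; rewrite eq_sym -subr_eq0 -sE s00.
  rewrite (_ : (fun g => _) = phi ord0)//; apply/funext => g.
  by rewrite big_ord_recl t01 mul1r big1 ?addr0// => i _; rewrite ti mul0r.
pose psi g := \sum_(i < m) t (lift ord0 i) / s * phi (lift ord0 i) g.
have Xpsi : X psi.
  apply: (IH (fun i => t (lift ord0 i) / s) (fun i => phi (lift ord0 i))) => //.
    by move=> i; rewrite divr_ge0.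
  by rewrite -mulr_suml mulfV.
have t01 : 0 <= t ord0 <= 1 by rewrite t0 -subr_ge0 -sE.
rewrite (_ : (fun g => _) = fun g => t ord0 * phi ord0 g + (1 - t ord0) * psi g).
  exact: Xconv.
apply/funext => g; rewrite big_ord_recl -sE; congr (_ + _).
rewrite mulr_sumr; apply: eq_bigr => i _.
by rewrite [in RHS]mulrA [s * _]mulrC divfK.
Qed.

Section Representation.
Context (rho : free_ultrafilter).
Context (theta : {multiplicative G -> unitary_group R rho}).
Local Notation phi := (fun g => utrace (theta g)).

Lemma cvg_conj (T : Type) (F : set_system T) {FF : Filter F} (f : T -> C) (l : C) :
  f @ F --> l -> (f t)^* @[t --> F] --> l^*.
Proof.
move=> /cvgrPdist_lt fl; apply/cvgrPdist_lt => e /fl; apply: filterS => t.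
by rewrite -rmorphB norm_conjC.
Qed.

(** For c = phi g this limit is 1 - |phi g| ^ 2, so |phi g| <= 1; for c = 1 it is
    2 - 2 Re (phi g), which vanishes only if theta g = 1 in the ultrapower. *)
Lemma theta_dist g (c : C) :
  norm2 (fun u => theta_lift theta g m u - c *: u) ^+ 2 @[m --> fuf rho] -->
    1 + c * c^* - (c^* * phi g + (c^* * phi g)^*).
Proof.
have distE m : norm2 (fun u => theta_lift theta g m u - c *: u) ^+ 2 =
    trace (bmul (bstar (theta_lift theta g)) (theta_lift theta g) m) + c * c^*
    - (c^* * trace (theta_lift theta g m) + (c^* * trace (theta_lift theta g m))^*).
  rewrite /norm2 hilbert_normB dotZr normrZ Omega_unit mulr1 normCK dot_norm.
  by rewrite /trace /= adjEl//; exact: bseq_in.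
under eq_fun do rewrite distE.
have tr1 : trace (bmul (bstar (theta_lift theta g)) (theta_lift theta g) m)
    @[m --> fuf rho] --> (1 : C).
  have -> : 1 = utrace (\pi_(ultrapower R rho)
      (bmul (bstar (theta_lift theta g)) (theta_lift theta g))).
    by rewrite -umul_pi -ustar_pi reprK unitaryVl utrace1.
  exact: utrace_pi.
have trg : c^* * trace (theta_lift theta g m) @[m --> fuf rho] --> c^* * phi g.
  by apply: cvgM; [exact: cvg_cst|exact: utrace_cvg].
exact: (cvgB (cvgD tr1 (cvg_cst (c * c^*))) (cvgD trg (cvg_conj trg))).
Qed.

Lemma utrace_theta_le1 g : `|phi g| <= 1.
Proof.
rewrite -(@ler_pXn2r _ 2) ?nnegrE// expr1n -subr_ge0.
have -> : 1 - `|phi g| ^+ 2 =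
    1 + phi g * (phi g)^* - ((phi g)^* * phi g + ((phi g)^* * phi g)^*).
  by rewrite normCK [(_ * _)^*]rmorphM /= conjCK; ring.
apply: (@cvg_nonneg C nat (fuf rho) _ _ _ _ (@theta_dist g (phi g))) => m.
by rewrite exprn_ge0// normr_ge0.
Qed.

Lemma utrace_theta_eq1 g : phi g = 1 -> theta g = 1%g.
Proof.
move=> phi1; apply: val_inj => /=; rewrite -[LHS]reprK; apply: pi_eq.
have := @theta_dist g 1; rewrite phi1 conjC1 !mulr1 conjC1 subrr => dist.
apply/ultra_eqP => e e0.
have /cvgrPdist_lt/(_ _ (exprn_gt0 2 e0)) := dist; apply: filterS => m.
rewrite sub0r normrN ger0_norm ?exprn_ge0 ?normr_ge0//.
rewrite ltr_pXn2r ?nnegrE ?(ltW e0) ?normr_ge0//.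
by rewrite /norm2 scale1r.
Qed.

End Representation.

Lemma Hyp_norm_le1 phi g : Hyp G R phi -> `|phi g| <= 1.
Proof. by move=> [_ [rho [theta <-]]]; exact: utrace_theta_le1. Qed.

Lemma Hyp_closed_ultralimits : closed_under_ultralimits (Hyp G R).
Proof.
move=> phi omega UU phiH.
have phi_cvg g : cvg (phi m g @[m --> omega]).
  by apply: (@ultra_cvg_complex K nat omega _ 1) => m; exact: Hyp_norm_le1.
by split; [exact: phi_cvg|exact: (@Hyp_lim omega _ _ _ phiH phi_cvg)].
Qed.

(** By the parallelogram identity
    |1 + z| ^ 2 = 2 + 2 |z| ^ 2 - |1 - z| ^ 2 < 4. The left-hand side has the
    shape of a convex combination as in [Hyp_convex]. *)
Lemma norm_midpoint_lt1 (z : C) : `|z| <= 1 -> z != 1 ->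
  `|2^-1 * 1 + (1 - 2^-1) * z| < 1.
Proof.
move=> z1 zn1.
have -> : 2^-1 * 1 + (1 - 2^-1) * z = (1 + z) / 2 by field.
rewrite normrM normfV normr_nat ltr_pdivrMr// mul1r.
rewrite -(@ltr_pXn2r _ 2) ?nnegrE//.
have zz : `|z| ^+ 2 <= 1 by rewrite exprn_ile1.
have d0 : 0 < `|1 - z| ^+ 2 by rewrite exprn_gt0// normr_gt0 subr_eq0 eq_sym.
have -> : `|1 + z| ^+ 2 = 2 + 2 * `|z| ^+ 2 - `|1 - z| ^+ 2.
  by rewrite !normCK rmorphB rmorphD rmorph1; ring.
rewrite ltrBlDr (@le_lt_trans _ _ (2 ^+ 2))//; last by rewrite ltrDl.
have -> : 2 ^+ 2 = 2 + 2 * 1 :> C by ring.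
by rewrite lerD2l ler_pM2l.
Qed.

Lemma cvg_expr_free (rho : free_ultrafilter) (z : C) : `|z| < 1 ->
  z ^+ m @[m --> fuf rho] --> (0 : C).
Proof.
move=> z1; apply/cvgrPdist_lt => e e0.
have /complex_realP[r zr] := normr_real z.
have /complex_realP[s es] := gtr0_real e0.
have r0 : 0 <= r by rewrite -ler0c -zr.
have r1 : `|r| < 1 by rewrite ger0_norm// -ltcR -zr.
have s0 : 0 < s by move: e0; rewrite es (ltcR 0).
have /cvgrPdist_lt/(_ _ s0)[N _ Ns] := cvg_expr r1.
have := free_near_ge rho N; apply: filterS => m /Ns /=.
rewrite !sub0r !normrN !normrX (ger0_norm r0) => rm.
by rewrite zr -rmorphXn/= es ltcR.
Qed.

(** The mean psi of 1 and the trace of theta has modulus < 1 outside of the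
    identity, so its powers converge to delta_e. *)
Lemma Hyp_delta_of_hyperlinear : hyperlinear G R -> Hyp G R delta_e.
Proof.
move=> [rho [theta theta_inj]].
pose phi g := utrace (theta g).
have phiH : Hyp G R phi by split; [exact: Cen_utrace_theta|exists rho, theta].
pose psi g : C := 2^-1 * punit C g + (1 - 2^-1) * phi g.
have psiH : Hyp G R psi.
  apply: Hyp_convex => //; last exact: Hyp_punit.
  by rewrite invr_ge0 ler0n/= invf_le1// ler1n.
have powH m : Hyp G R (fun g => psi g ^+ m).
  elim: m => [|m IH]; first exact: Hyp_punit.
  have := Hyp_pmul psiH IH; congr (Hyp G R _).
  by apply/funext => g; rewrite /pmul exprS.
apply: (Hyp_lim (omega := fuf rho) _ powH) => g.
rewrite /delta_e; case: eqVneq => [->|g1] /=.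
  have psi1 : psi 1%g = 1.
    by rewrite /psi /punit /phi theta1 utrace1; field.
  have -> : (fun m => psi 1%g ^+ m) = fun=> 1.
    by apply/funext => m; rewrite psi1 expr1n.
  exact: (@cvg_cst C 1 nat (fuf rho) _).
apply: cvg_expr_free; apply: norm_midpoint_lt1; first exact: utrace_theta_le1.
apply/eqP => /utrace_theta_eq1; rewrite -(theta1 theta) => /theta_inj g1'.
by rewrite g1' eqxx in g1.
Qed.

Lemma hyperlinear_of_Hyp_delta : Hyp G R delta_e -> hyperlinear G R.
Proof.
move=> [_ [rho [theta thetaE]]]; exists rho, theta => g h gh.
have : utrace (theta (g^-1 * h)%g) = 1.
  by rewrite gmulfM -gh thetaV mulVg utrace1.
rewrite thetaE /delta_e; case: eqVneq => [gh1 _|_ /eqP].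
  by apply: (mulgI (g^-1)%g); rewrite mulVg gh1.
by rewrite eq_sym oner_eq0.
Qed.

(** An annihilator phi satisfies phi = delta_e phi = delta_e as phi 1 = 1. *)
Lemma annihilators_delta : Hyp G R delta_e ->
  annihilators (Hyp G R) = [set delta_e].
Proof.
move=> deltaH; apply/seteqP; split=> [phi [phiH ann]|_ ->].
  have [_ <-] := ann _ deltaH; apply/funext => g; rewrite /pmul /delta_e.
  case: eqVneq => [->|_]; last by rewrite mul0r.
  by have [[_ _ ->] _] := phiH; rewrite mulr1.
split=> // psi [[_ _ psi1] _].
by split; apply/funext => g; rewrite /pmul /delta_e; case: eqVneq => [->|_];
  rewrite ?psi1 ?mulr1 ?mulr0 ?mul0r.
Qed.

End Closure.

Theorem proposition2p11 (K : realType) (R : hyperfiniteII1 K[i]) (G : groupType) :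
  [/\ is_submonoid (Hyp G R) (Cen K[i] G),
      closed_under_ultralimits (Hyp G R),
      closed_under_convex_combinations (Hyp G R) &
      countable [set: G] ->
        (annihilators (Hyp G R) = [set delta_e] <-> hyperlinear G R)].
Proof.
split.
- split=> [phi []//||phi psi]; [exact: Hyp_punit|exact: Hyp_pmul].
- exact: Hyp_closed_ultralimits.
- by apply: convex_combinations => t phi psi; exact: Hyp_convex.
- move=> _; split=> [ann|hyp].
    apply: hyperlinear_of_Hyp_delta.
    by have [] : annihilators (Hyp G R) delta_e by rewrite ann.
  exact/annihilators_delta/Hyp_delta_of_hyperlinear.
Qed.
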